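(* Let $0<\lambda<e^{-(\log L+L)}$. Then $\infty$ is an explosion point for the set $\mathcal{E}(\mathcal{J}(\mathcal{Z}_\lambda))$ of endpoints of the hairs in the Julia set $\mathcal{J}(\mathcal{Z}_\lambda)$ of the Zorich map $\mathcal{Z}_\lambda=\lambda\mathcal{Z}:\mathbb{R}^3\to\mathbb{R}^3$; that is, $\mathcal{E}(\mathcal{J}(\mathcal{Z}_\lambda))$ is totally separated while $\mathcal{E}(\mathcal{J}(\mathcal{Z}_\lambda))\cup\{\infty\}$ is connected.
   Context: Zorich maps. Let $Q=\{(x_1,x_2)\in\mathbb{R}^2:|x_1|\le 1,|x_2|\le 1\}$ and let $h=(h_1,h_2,h_3)$ be a sense-preserving $L$-bi-Lipschitz map (i.e. $L^{-1}|u-v|\le|h(u)-h(v)|\le L|u-v|$) from $Q$ onto the upper hemisphere $\{x\in\mathbb{R}^3:|x|=1,\ x_3\ge 0\}$. Define $\mathcal{Z}(x_1,x_2,x_3)=e^{x_3}h(x_1,x_2)$ on $Q\times\mathbb{R}$ and extend $\mathcal{Z}$ to $\mathbb{R}^3$ by repeatedly reflecting across the sides of the square beam in the domain and across the plane $x_3=0$ in the range. Explicitly, if $|x_1-2n|\le1$, $|x_2-2m|\le 1$ with $n,m\in\mathbb{Z}$, and $u=((-1)^n(x_1-2n),(-1)^m(x_2-2m))\in Q$, then $\mathcal{Z}(x)=e^{x_3}(h_1(u),h_2(u),(-1)^{n+m}h_3(u))$. For $\lambda>0$ put $\mathcal{Z}_\lambda=\lambda\mathcal{Z}$; it is a quasiregular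 map of transcendental type. Julia set. For a quasiregular map of transcendental type $f:\mathbb{R}^d\to\mathbb{R}^d$, $\mathcal{J}(f)$ is the set of all $x\in\mathbb{R}^d$ such that $\operatorname{cap}\left(\mathbb{R}^d\setminus\bigcup_{k=1}^\infty f^k(U)\right)=0$ for every neighbourhood $U$ of $x$, where $\operatorname{cap}$ is conformal capacity: a compact set $F$ has capacity zero if $\inf\int|\nabla u|^d=0$, the infimum being over $u\in C_0^\infty(A)$ with $u\ge 1$ on $F$, for some (equivalently every) bounded open $A\supset F$; a closed set has capacity zero if all of its compact subsets do. Hairs. A subset $H\subset\mathbb{R}^3$ is a hair if there is a homeomorphism $\gamma:[0,\infty)\to H$ with $\gamma(t)\to\infty$ as $t\to\infty$; $\gamma(0)$ is the endpoint of the hair. For $0<\lambda<e^{-(\log L+L)}$, it is known that $\mathcal{J}(\mathcal{Z}_\lambda)$ is a union of uncountably many pairwise disjoint hairs, each tending to $\infty$ with third coordinate tending to $\infty$ and the other two coordinates bounded. $\mathcal{E}(\mathcal{J}(\mathcal{Z}_\lambda))$ denotes the set of endpoints of these hairs. A space $Y$ is totally separated if for any two distinct $x,y\in Y$ there is a clopen $U\subset Y$ with $x\in U$, $y\notin U$. Sets containing $\infty$ carry the subspace topology from the one-point compactification $\mathbb{R}^3\cup\{\infty\}$. *)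

(* Defs.v *)
From HB Require Import structures.
From mathcomp Require Import all_boot all_order all_algebra.
From mathcomp Require Import all_classical all_reals all_analysis.

Set Implicit Arguments.
Unset Strict Implicit.
Unset Printing Implicit Defensive.

Import Order.TTheory GRing.Theory Num.Theory.
Import numFieldNormedType.Exports.

Local Open Scope classical_set_scope.
Local Open Scope ring_scope.

Definition row2 {R : realType} (a b : R) : 'rV[R]_2 := \row_j [:: a; b]`_j.

Definition row3 {R : realType} (a b c : R) : 'rV[R]_3 :=
  \row_j [:: a; b; c]`_j.

(* The library norm on ['rV_n] is the sup norm; the topology is the same. *)
Definition enorm {R : realType} {n : nat} (v : 'rV[R]_n) : R :=
  Num.sqrt (\sum_i v ord0 i ^+ 2).

(* The library has no Lebesgue measure on ['rV_n]: integrals and null sets are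
   taken on [R * R] and [R * R * R] through [row2] and [row3]. *)
Definition lebesgue2 {R : realType} :=
  (@lebesgue_measure R \x @lebesgue_measure R)%E.

Definition lebesgue3 {R : realType} :=
  (@lebesgue2 R \x @lebesgue_measure R)%E.

Definition square {R : realType} : set 'rV[R]_2 :=
  [set u | forall i, `|u ord0 i| <= 1].

Definition upper_hemisphere {R : realType} : set 'rV[R]_3 :=
  [set x | enorm x = 1 /\ 0 <= x ord0 2].

Definition bilipschitz_on {R : realType} {m n : nat} (L : R)
    (A : set 'rV[R]_m) (f : 'rV[R]_m -> 'rV[R]_n) : Prop :=
  forall u v, A u -> A v ->
    L^-1 * enorm (u - v) <= enorm (f u - f v) <= L * enorm (u - v).

(* The hemisphere is oriented by its outward normal, which at [h u] is [h u]
   itself, and ['J h u] has rows [D_1 h u] and [D_2 h u]. With this orientation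
   [(x1, x2, x3) |-> expR x3 *: h (x1, x2)] has positive Jacobian determinant.
   A bi-Lipschitz map is differentiable almost everywhere. *)
Definition sense_preserving_on_square {R : realType}
    (h : 'rV[R]_2 -> 'rV[R]_3) : Prop :=
  {ae @lebesgue2 R, forall p : R * R,
     let u := row2 p.1 p.2 in
     interior square u -> differentiable h u ->
     0 < \det (col_mx ('J h u) (h u) : 'M[R]_3)}.

(* Adjacent cells overlap in their faces. The formulas agree there when [h] is
   a bi-Lipschitz map of the square onto the hemisphere, since it then maps the
   boundary of the square onto the equator: such an [h] has exactly one [Z]. *)
Definition zorich_map {R : realType} (h : 'rV[R]_2 -> 'rV[R]_3)
    (Z : 'rV[R]_3 -> 'rV[R]_3) : Prop :=
  forall (x : 'rV[R]_3) (n m : int),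
    `|x ord0 0 - 2 * n%:~R| <= 1 -> `|x ord0 1 - 2 * m%:~R| <= 1 ->
    let u := row2 ((-1) ^ n * (x ord0 0 - 2 * n%:~R))
                  ((-1) ^ m * (x ord0 1 - 2 * m%:~R)) in
    Z x = expR (x ord0 2) *:
      row3 (h u ord0 0) (h u ord0 1) ((-1) ^ (n + m) * h u ord0 2).

Definition partial {R : realType} {n : nat} (i : 'I_n)
    (g : 'rV[R]_n -> R) : 'rV[R]_n -> R :=
  fun x => 'D_(delta_mx ord0 i) g x.

Definition smooth {R : realType} {n : nat} (g : 'rV[R]_n -> R) : Prop :=
  forall s : seq 'I_n,
    let D := foldr partial g s in
    continuous D /\ forall i x, derivable D x (delta_mx ord0 i).

Definition test_function {R : realType} {n : nat} (A : set 'rV[R]_n)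
    (g : 'rV[R]_n -> R) : Prop :=
  [/\ smooth g, compact (closure [set x | g x != 0])
    & closure [set x | g x != 0] `<=` A].

Definition grad {R : realType} {n : nat} (g : 'rV[R]_n -> R)
    (x : 'rV[R]_n) : 'rV[R]_n := \row_i partial i g x.

Definition conformal_energy {R : realType} (g : 'rV[R]_3 -> R) : \bar R :=
  (\int[@lebesgue3 R]_p (enorm (grad g (row3 p.1.1 p.1.2 p.2)) ^+ 3)%:E)%E.

Definition condenser_capacity {R : realType} (A F : set 'rV[R]_3) : \bar R :=
  ereal_inf [set conformal_energy g | g in
    [set g | test_function A g /\ forall x, F x -> 1 <= g x]].

(* Replacing [exists A] by "for every such [A]" gives an equivalent notion. *)
Definition compact_cap_zero {R : realType} (F : set 'rV[R]_3) : Prop :=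
  exists A, [/\ open A, bounded_set A, F `<=` A
              & condenser_capacity A F = 0%E].

Definition cap_zero {R : realType} (S : set 'rV[R]_3) : Prop :=
  forall F, compact F -> F `<=` S -> compact_cap_zero F.

Definition julia {R : realType} (f : 'rV[R]_3 -> 'rV[R]_3) : set 'rV[R]_3 :=
  [set x | forall U, nbhs x U ->
     cap_zero (~` \bigcup_(k in [set k | (0 < k)%N]) (iter k f @` U))].

Definition hair_parametrization {R : realType} (H : set 'rV[R]_3)
    (gamma : R -> 'rV[R]_3) : Prop :=
  [/\ {within `[0, +oo[, continuous gamma},
      gamma @` `[0, +oo[ = H,
      exists2 delta : 'rV[R]_3 -> R,
        {within H, continuous delta} & {in `[0, +oo[, cancel gamma delta}
    & (Some (gamma t) : one_point_compactification 'rV[R]_3) @[t --> +oo]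
        --> (None : one_point_compactification 'rV[R]_3)].

Definition hair {R : realType} (H : set 'rV[R]_3) : Prop :=
  exists gamma, hair_parametrization H gamma.

Definition hair_endpoint {R : realType} (H : set 'rV[R]_3)
    (x : 'rV[R]_3) : Prop :=
  exists2 gamma, hair_parametrization H gamma & gamma 0 = x.

Definition hair_decomposition {R : realType} (X : set 'rV[R]_3)
    (HH : set (set 'rV[R]_3)) : Prop :=
  [/\ HH `<=` hair, trivIset HH id & \bigcup_(H in HH) H = X].

(* When each connected component of [X] is a hair, as for the Julia set of
   [lambda *: Z] with [lambda] small, [X] has exactly one decomposition: a hair in a component
   contains a tail of that component, so two disjoint ones cannot share it. *)
Definition endpoints {R : realType} (X : set 'rV[R]_3) : set 'rV[R]_3 :=
  [set x | exists HH, hair_decomposition X HH /\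
             exists2 H, HH H & hair_endpoint H x].

(* The library's [zero_dimensional T] is the usual notion "[T] is totally
   separated": distinct points are separated by a clopen set. *)
Definition explosion_at_infinity {X : topologicalType} (E : set X) : Prop :=
  zero_dimensional E /\
  connected ((Some @` E `|` [set None]) : set (one_point_compactification X)).

(* Main.v *)
Require Import Defs.
From HB Require Import structures.
From mathcomp Require Import all_boot all_order all_algebra.
From mathcomp Require Import all_classical all_reals all_analysis.
From mathcomp Require Import measurable_realfun ring lra.
Set Implicit Arguments.
Unset Strict Implicit.
Unset Printing Implicit Defensive.
Import Order.TTheory GRing.Theory Num.Theory.
Import numFieldNormedType.Exports.
Local Open Scope classical_set_scope.
Local Open Scope ring_scope.

(** Write f for the scaled Zorich map and M for the height at which f maps a
    horizontal plane to the sphere of radius L. The bound on lambda gives M >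
    L. Below height M the map f falls into the ball of radius L, which lies
    below height M; above, f expands every beam over a square cell by a factor
    at least kappa = M / L > 1 ([zf_expanding]), radially because the
    exponential does and tangentially because h is bi-Lipschitz.

    The Julia set is the set J of points with orbit above M ([julia_zf]). A
    point off J has a neighbourhood with bounded iterates, which miss a box,
    and boxes have positive capacity because a test function has to grow by 1
    along each vertical line through the box ([box_capacity_gt0]). Around a
    point of J, expansion makes the iterates of a neighbourhood cover regions
    so large that any given point but the origin is covered two iterates later
    ([J_near_cover]), and a point has zero capacity: average N copies of a
    bump at N scales ([cap_zero_point]).

    Points of J are coded by the cells their orbits visit. In a class of
    points with the same itinerary, two distinct points are eventually more
    than 3 units apart in height, by expansion, and then the higher one stays
    higher: its image is much farther from the origin, in the same beam. So a
    class is linearly ordered, compatibly with the topology, and a hair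
    contained in J is, by connectedness, an upper part of a class. Hence every
    decomposition of J into hairs has the classes for hairs, and the endpoints
    are the lowest points of the classes ([endpoints_lowest]).

    Two endpoints have different itineraries, and itineraries are locally
    constant on J, so the endpoints are totally separated. The connectedness
    follows the proof of Erdos that the rational points of Hilbert space have
    no bounded non-empty clopen part. Shifting a far iterate of an endpoint by
    periods of f and pulling the result back gives endpoints again
    ([perturb_lowest]); the first shifts leave the endpoint almost where it
    is, all steps are tiny, and they lead to infinity, so that there is a last
    one in a given bounded clopen part ([exit_step]). Iterating this with
    later and later iterates yields a sequence that comes closer and closer to
    the outside. It accumulates at a point of J; the shifts only moved the
    itineraries away from the axis, and this makes the limit the lowest point
    of its class ([lowest_limit]). So the limit is an endpoint in the clopen
    part with endpoints of the outside arbitrarily near to it, a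
    contradiction. *)

(** * Euclidean norm and coordinates *)

Section Norm.
Variable R : realType.

Lemma row3E (a b c : R) :
  (row3 a b c ord0 0 = a) * (row3 a b c ord0 1 = b) * (row3 a b c ord0 2 = c).
Proof. by rewrite /row3 !mxE. Qed.

Lemma ord3P (P : 'I_3 -> Prop) : P 0 -> P 1 -> P 2 -> forall i, P i.
Proof.
move=> P0 P1 P2 [[|[|[|//]]] i].
- by rewrite (_ : Ordinal _ = 0)//; exact/val_inj.
- by rewrite (_ : Ordinal _ = 1)//; exact/val_inj.
- by rewrite (_ : Ordinal _ = 2)//; exact/val_inj.
Qed.

Lemma enorm_ge0 n (x : 'rV[R]_n) : 0 <= enorm x.
Proof. exact: sqrtr_ge0. Qed.

Lemma sqr_enorm n (x : 'rV[R]_n) : enorm x ^+ 2 = \sum_i x ord0 i ^+ 2.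
Proof. by rewrite sqr_sqrtr// sumr_ge0// => i _; exact: sqr_ge0. Qed.

Lemma sqr_enorm3 (x : 'rV[R]_3) :
  enorm x ^+ 2 = x ord0 0 ^+ 2 + x ord0 1 ^+ 2 + x ord0 2 ^+ 2.
Proof.
rewrite sqr_enorm !big_ord_recr big_ord0 /= add0r.
by congr (_ ^+ _ + _ ^+ _ + _ ^+ _); congr (x _ _); exact/val_inj.
Qed.

Lemma sqr_enorm2 (u : 'rV[R]_2) :
  enorm u ^+ 2 = u ord0 0 ^+ 2 + u ord0 1 ^+ 2.
Proof.
rewrite sqr_enorm !big_ord_recr big_ord0 /= add0r.
by congr (_ ^+ _ + _ ^+ _); congr (u _ _); exact/val_inj.
Qed.

Lemma enorm_le_sqr n (x : 'rV[R]_n) (c : R) : 0 <= c ->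
  (enorm x <= c) = (enorm x ^+ 2 <= c ^+ 2).
Proof. by move=> c0; rewrite ler_pXn2r// nnegrE enorm_ge0. Qed.

Lemma coord_le_enorm n (x : 'rV[R]_n) i : `|x ord0 i| <= enorm x.
Proof.
rewrite -sqrtr_sqr; apply: ler_wsqrtr.
by rewrite (bigD1 i)//= lerDl sumr_ge0// => j _; exact: sqr_ge0.
Qed.

Lemma enorm_le_sum3 (x : 'rV[R]_3) :
  enorm x <= `|x ord0 0| + `|x ord0 1| + `|x ord0 2|.
Proof.
have a0 := normr_ge0 (x ord0 0); have b0 := normr_ge0 (x ord0 1).
have c0 := normr_ge0 (x ord0 2); rewrite enorm_le_sqr; last by lra.
rewrite sqr_enorm3 -!(real_normK (num_real (x _ _))).
have := mulr_ge0 a0 b0; have := mulr_ge0 a0 c0; have := mulr_ge0 b0 c0.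
by move=> *; lra.
Qed.

Lemma enorm_le_coordD (x z : 'rV[R]_3) (a b c : R) :
  0 <= a -> 0 <= b -> 0 <= c ->
  `|x ord0 0| <= `|z ord0 0| + a -> `|x ord0 1| <= `|z ord0 1| + b ->
  `|x ord0 2| <= `|z ord0 2| + c -> enorm x <= enorm z + (a + b + c).
Proof.
move=> a0 b0 c0 xa xb xc; have z0 := enorm_ge0 z.
rewrite enorm_le_sqr; last by lra.
have := coord_le_enorm z 0; have := coord_le_enorm z 1.
have := coord_le_enorm z 2.
rewrite sqrrD !sqr_enorm3 -!(real_normK (num_real (x _ _))).
rewrite -!(real_normK (num_real (z _ _))).
have := normr_ge0 (z ord0 0); have := normr_ge0 (z ord0 1).
have := normr_ge0 (z ord0 2).
move: xa xb xc (normr_ge0 (x ord0 0)) (normr_ge0 (x ord0 1)) (normr_ge0 (x ord0 2)).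
move: `|x ord0 0| `|x ord0 1| `|x ord0 2| `|z ord0 0| `|z ord0 1| `|z ord0 2|.
move: (enorm z) => n x0 x1 x2 z0' z1 z2 h0 h1 h2 p0 p1 p2 q2 q1 q0 n2 n1 n0.
have e0 : x0 ^+ 2 <= (z0' + a) ^+ 2 by rewrite lerXn2r// nnegrE addr_ge0.
have e1 : x1 ^+ 2 <= (z1 + b) ^+ 2 by rewrite lerXn2r// nnegrE addr_ge0.
have e2 : x2 ^+ 2 <= (z2 + c) ^+ 2 by rewrite lerXn2r// nnegrE addr_ge0.
have f0 : z0' * a <= n * a by rewrite ler_wpM2r.
have f1 : z1 * b <= n * b by rewrite ler_wpM2r.
have f2 : z2 * c <= n * c by rewrite ler_wpM2r.
have ab0 := mulr_ge0 a0 b0; have ac0 := mulr_ge0 a0 c0.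
have bc0 := mulr_ge0 b0 c0.
lra.
Qed.

Lemma enormZ n (a : R) (x : 'rV[R]_n) : enorm (a *: x) = `|a| * enorm x.
Proof.
rewrite /enorm -sqrtr_sqr -sqrtrM ?sqr_ge0// mulr_sumr; congr Num.sqrt.
by apply: eq_bigr => i _; rewrite mxE exprMn.
Qed.

Lemma enorm0 n : enorm (0 : 'rV[R]_n) = 0.
Proof. by rewrite -(scale0r 0) enormZ normr0 mul0r. Qed.

Lemma enorm_eq0 n (x : 'rV[R]_n) : enorm x = 0 -> x = 0.
Proof.
move=> x0; apply/rowP => i; rewrite mxE; apply/eqP.
by rewrite -normr_le0 -x0 coord_le_enorm.
Qed.

Lemma near_coord_dist n (x : 'rV[R]_n) i (e : R) : 0 < e ->
  \forall y \near x, `|x ord0 i - (y : 'rV[R]_n) ord0 i| < e.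
Proof.
by move=> e0; apply/nbhs_ballP; exists e => //= y [_ xy]; exact: xy.
Qed.

Lemma near_lt (T : topologicalType) (g : T -> R) (x : T) (c : R) :
  continuous g -> g x < c -> \forall y \near x, g y < c.
Proof. by move=> gc gx; apply: (cvgr_lt (g x)) => //; exact: gc. Qed.

Lemma near_gt (T : topologicalType) (g : T -> R) (x : T) (c : R) :
  continuous g -> c < g x -> \forall y \near x, c < g y.
Proof. by move=> gc gx; apply: (cvgr_gt (g x)) => //; exact: gc. Qed.

Lemma closed_ge_fun (T : topologicalType) (g : T -> R) (c : R) :
  continuous g -> closed [set x | c <= g x].
Proof.
move=> gc; rewrite (_ : [set x | c <= g x] = ~` (g @^-1` [set t | t < c])).
  by apply: open_closedC; apply: open_comp; [move=> x _; exact: gc|exact: open_lt].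
by apply/seteqP; split=> x /=; rewrite leNgt => /negP.
Qed.

Lemma continuous_add (T : topologicalType) (f g : T -> R) :
  continuous f -> continuous g -> continuous (fun t => f t + g t).
Proof. by move=> fc gc t; apply: cvgD; [exact: fc|exact: gc]. Qed.

Lemma continuous_mul (T : topologicalType) (f g : T -> R) :
  continuous f -> continuous g -> continuous (fun t => f t * g t).
Proof. by move=> fc gc t; apply: cvgM; [exact: fc|exact: gc]. Qed.

Lemma continuous_sqr_dist (T : topologicalType) (c : R) (f : T -> R) :
  continuous f -> continuous (fun t => (c - f t) ^+ 2).
Proof.
move=> fc; under eq_fun do rewrite expr2.
by apply: continuous_mul => t; apply: cvgB;
  [exact: cvg_cst|exact: fc|exact: cvg_cst|exact: fc].
Qed.

Lemma continuous_cube (T : topologicalType) (f : T -> R) :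
  continuous f -> continuous (fun t => f t ^+ 3).
Proof.
move=> fc; under eq_fun do rewrite exprS expr2.
by apply: continuous_mul => //; exact: continuous_mul.
Qed.

Lemma continuous_enorm3 (T : topologicalType) (f : T -> 'rV[R]_3) :
  (forall i, continuous (fun t => f t ord0 i)) ->
  continuous (fun t => enorm (f t)).
Proof.
move=> fc t.
have -> : (fun t => enorm (f t)) = (fun t => Num.sqrt
    (f t ord0 0 * f t ord0 0 + f t ord0 1 * f t ord0 1 +
     f t ord0 2 * f t ord0 2)).
  apply/funext => s; rewrite -!expr2 -sqr_enorm3 sqrtr_sqr.
  by rewrite ger0_norm// enorm_ge0.
have sum_cvg : (f s ord0 0 * f s ord0 0 + f s ord0 1 * f s ord0 1 +
      f s ord0 2 * f s ord0 2) @[s --> t] -->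
    (f t ord0 0 * f t ord0 0 + f t ord0 1 * f t ord0 1 +
      f t ord0 2 * f t ord0 2).
  by apply: cvgD; first apply: cvgD; apply: cvgM; exact: fc.
by apply: cvg_comp; [exact: sum_cvg|exact: sqrt_continuous].
Qed.

Lemma continuous_compose (T U V : topologicalType) (f : T -> U) (g : U -> V) :
  continuous f -> continuous g -> continuous (fun t => g (f t)).
Proof. by move=> fc gc t; exact: (continuous_comp (fc t) (gc _)). Qed.

End Norm.

(** * Integration over three-space *)

Section Fubini3.
Context d (T : measurableType d) (R : realType).
Variable m : {sigma_finite_measure set T -> \bar R}.

(** Named in order to carry the sigma-finite structure that the second use of
    Tonelli's theorem asks for. *)
Definition square_measure : set (T * T) -> \bar R := (m \x m)%E.

HB.instance Definition _ := Measure.on square_measure.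

Lemma square_measure_sigma_finite : sigma_finite setT square_measure.
Proof.
have /sigma_finiteP[F [TF ndF Foo]] := sigma_finiteT m.
exists (fun n => F n `*` F n) => [|n]; last first.
  have [mF ltF] := Foo n; split; first exact: measurableX.
  by rewrite /square_measure product_measure1E// lte_mul_pinfty// ge0_fin_numE.
apply/esym/seteqP; split => // -[x y] _.
have [k _ Fkx] : (\bigcup_k F k) x by rewrite -TF.
have [l _ Fly] : (\bigcup_k F k) y by rewrite -TF.
exists (maxn k l) => //; split => /=.
  by move: x Fkx; exact/subsetPset/ndF/leq_maxl.
by move: y Fly; exact/subsetPset/ndF/leq_maxr.
Qed.

HB.instance Definition _ := Measure_isSigmaFinite.Build _ _ _ square_measure
  square_measure_sigma_finite.

Lemma fubini3 (f : T * T * T -> \bar R) :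
  measurable_fun [set: T * T * T] f -> (forall p, (0 <= f p)%E) ->
  (\int[(m \x m) \x m]_p f p = \int[m]_a \int[m]_b \int[m]_c f (a, b, c))%E.
Proof.
move=> mf f0.
have mF := measurable_fun_fubini_tonelli_F (m2 := m) f mf f0.
have F0 p : (0 <= fubini_F m f p)%E by exact: integral_ge0.
have h1 := fubini_tonelli1 (m1 := square_measure) f mf f0.
have h2 := fubini_tonelli1 (m1 := m) (m2 := m) _ mF F0.
transitivity (\int[(m \x m)%E]_x fubini_F m f x)%E; [exact: h1|exact: h2].
Qed.

End Fubini3.

Section Measure.
Variable R : realType.
Notation l1 := (@lebesgue_measure R).

Lemma near_box (V : set 'rV[R]_3) (x : 'rV[R]_3) : nbhs x V ->
  exists2 e : R, 0 < e & forall y : 'rV[R]_3, (forall i, `|x ord0 i - y ord0 i| < e) -> V y.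
Proof.
move=> /nbhs_ballP[e /= e0 xeV]; exists e => // y xy; apply: xeV.
split=> // i j; rewrite /ball/= ord1; exact: xy.
Qed.

(** Continuous functions are measurable for the product sigma-algebra because
    an open set is a countable union of boxes with rational corners. *)
Lemma open_measurable_row3 (V : set 'rV[R]_3) : open V ->
  measurable [set p : measurableTypeR R * measurableTypeR R * measurableTypeR R
             | V (row3 p.1.1 p.1.2 p.2)].
Proof.
move=> oV.
pose itv (q : rat * rat) : set (measurableTypeR R) :=
  `](ratr q.1 : R), (ratr q.2 : R)[%classic.
pose box (q : (rat * rat) * (rat * rat) * (rat * rat)) :=
  (itv q.1.1 `*` itv q.1.2) `*` itv q.2.
pose good q := box q `<=` [set p | V (row3 p.1.1 p.1.2 p.2)].
have -> : [set p | V (row3 p.1.1 p.1.2 p.2)] =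
    \bigcup_q (if `[< good q >] then box q else set0).
  apply/seteqP; split => [[[a b] c] /= Vp|p [q _]]; last first.
    by case: asboolP => // gq; exact: gq.
  have [e e0 eV] := near_box (open_nbhs_nbhs (conj oV Vp)).
  have approx (t : R) : exists q, itv q t /\
      forall s, itv q s -> `|t - s| < e.
    have h1 : t - e / 2 < t by rewrite ltrBlDr ltrDl divr_gt0.
    have h2 : t < t + e / 2 by rewrite ltrDl divr_gt0.
    have [q1 /[!in_itv]/= /andP[q11 q12]] := rat_in_itvoo h1.
    have [q2 /[!in_itv]/= /andP[q21 q22]] := rat_in_itvoo h2.
    exists (q1, q2); split; first by rewrite /itv /= in_itv /= q12.
    move=> s; rewrite /itv /= in_itv /= => /andP[s1 s2].
    by rewrite ltr_norml; apply/andP; split; lra.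
  have [qa [aq qaP]] := approx a.
  have [qb [bq qbP]] := approx b.
  have [qc [cq qcP]] := approx c.
  exists (qa, qb, qc) => //; case: asboolP => // -[]//.
  move=> [[a' b'] c'] [[/= /qaP ha /qbP hb] /qcP hc].
  by apply: eV; apply: ord3P; rewrite !row3E.
apply: countable_bigcupT_measurable => [|q]; first exact/countableP.
case: asboolP => // _.
by apply: measurableX; first apply: measurableX; exact: measurable_itv.
Qed.

Lemma continuous_measurable_row3 (g : 'rV[R]_3 -> R) : continuous g ->
  measurable_fun
    [set: measurableTypeR R * measurableTypeR R * measurableTypeR R]
    (fun p => g (row3 p.1.1 p.1.2 p.2)).
Proof.
move=> /continuousP cg.
set G := fun p => _.
have sub : preimage_set_system setT G (@RGenOpens.G R) `<=` measurable.
  move=> _ [_ [a [b ->]] <-]; rewrite setTI.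
  have := @open_measurable_row3 (g @^-1` `]a, b[%classic); apply.
  by apply: cg; exact: interval_open.
exact: (measurability _ (RGenOpens.measurableE R) sub).
Qed.

End Measure.

(** * Boxes have positive conformal capacity *)

Section Capacity_box.
Variable R : realType.
Notation l1 := (@lebesgue_measure R).

Lemma smooth_continuous_energy (g : 'rV[R]_3 -> R) : smooth g ->
  continuous (fun x => enorm (grad g x) ^+ 3).
Proof.
move=> gs; apply: continuous_cube; apply: continuous_enorm3 => i.
have -> : (fun t : 'rV[R]_3 => grad g t ord0 i) = partial i g.
  by apply/funext => y; rewrite mxE.
by have [] := gs [:: i].
Qed.

Lemma ler_eps_cube (e t : R) : 0 < e -> 0 <= t -> t <= e + e ^- 2 * t ^+ 3.
Proof.
move=> e0 t0; have [te|et] := leP t e.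
  apply: (le_trans te); rewrite lerDl mulr_ge0 ?exprn_ge0// invr_ge0.
  by rewrite exprn_ge0// ltW.
rewrite -[leLHS]add0r lerD ?(ltW e0)// ler_pdivlMl ?exprn_gt0//.
by rewrite [leRHS]exprSr ler_wpM2r// lerXn2r// ?nnegrE ltW.
Qed.

(** Hoelder's inequality on a segment, through [t <= e + t^3 / e^2]: a growth by
    1 over a bounded length costs a definite amount of energy. *)
Lemma line_energy (f df H : R -> R) (a b : R) : a < b ->
  (forall t, is_derive (t : R) 1 f (df t)) -> continuous df ->
  continuous H -> (forall t, `|df t| ^+ 3 <= H t) -> f a = 0 -> 1 <= f b ->
  (((2 * (b - a)) ^- 2 / 2)%:E <= \int[l1]_t (H t)%:E)%E.
Proof.
move=> ab fdf cdf cH dfH fa fb.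
have H0 t : 0 <= H t by apply: le_trans (dfH t); rewrite exprn_ge0.
have mH D : measurable_fun D (EFin \o H).
  apply/measurable_EFinP; apply: (measurable_funS measurableT) => //.
  exact: continuous_measurable_fun.
(* With this [e], the constant part of the bound integrates to 1 / 2. *)
pose e : R := (2 * (b - a))^-1.
have e0 : 0 < e by rewrite invr_gt0 mulr_gt0// subr_gt0.
have mI : measurable (`[a, b]%classic : set (measurableTypeR R)).
  exact: measurable_itv.
have cI : compact (`[a, b]%classic : set R) by exact: segment_compact.
have cf : continuous f.
  move=> t; apply: differentiable_continuous; apply/derivable1_diffP.
  by case: (fdf t).
have ftc : (\int[l1]_(t in `[a, b]) (df t)%:E = (f b)%:E - (f a)%:E)%E.
  apply: continuous_FTC2 => //.
  - exact: continuous_subspaceT.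
  - split.
    + by move=> t _; case: (fdf t).
    + by apply: cvg_at_right_filter; exact: cf.
    + by apply: cvg_at_left_filter; exact: cf.
  - by move=> t _; rewrite derive1E (derive_val (is_derive:=fdf t)).
have cG : continuous (fun t => e + e ^- 2 * H t).
  move=> t; apply: cvgD; first exact: cvg_cst.
  by apply: cvgM; [exact: cvg_cst|exact: cH].
have le1 : (1%:E <= \int[l1]_(t in `[a, b]) (e + e ^- 2 * H t)%:E)%E.
  apply: (@le_trans _ _ (\int[l1]_(t in `[a, b]) (df t)%:E)%E).
    by rewrite ftc fa sube0 lee_fin.
  apply: le_integral => //.
  - by apply: continuous_compact_integrable => //; exact: continuous_subspaceT.
  - by apply: continuous_compact_integrable => //; exact: continuous_subspaceT.
  move=> t _; rewrite lee_fin.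
  apply: (le_trans (ler_norm _)).
  apply: (le_trans (ler_eps_cube e0 (normr_ge0 _))).
  by rewrite lerD2l ler_wpM2l// invr_ge0 exprn_ge0// ltW.
have : (\int[l1]_(t in `[a, b]) (e + e ^- 2 * H t)%:E =
   (e * (b - a))%:E + (e ^- 2)%:E * \int[l1]_(t in `[a, b]) (H t)%:E)%E.
  under eq_integral do rewrite EFinD EFinM.
  rewrite ge0_integralD//.
  - rewrite integral_cst//= lebesgue_measure_itv/= lte_fin ab -EFinB -EFinM.
    rewrite ge0_integralZl//; first exact: mH.
    + by move=> t _; rewrite lee_fin.
    + by rewrite lee_fin invr_ge0 exprn_ge0// ltW.
  - by move=> t _; rewrite lee_fin ltW.
  - by move=> t _; rewrite -EFinM lee_fin mulr_ge0// invr_ge0 exprn_ge0// ltW.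
  - apply/measurable_EFinP; apply: measurable_funM => //.
    by apply/measurable_EFinP; exact: mH.
move=> E; move: le1; rewrite {}E => le1.
apply: (@le_trans _ _ (\int[l1]_(t in `[a, b]) (H t)%:E)%E); last first.
  apply: ge0_subset_integral => //; first exact: mH.
  by move=> t _; rewrite lee_fin.
have ba : e * (b - a) = 2^-1.
  have ba0 : b - a != 0 by rewrite subr_eq0 gt_eqF.
  by rewrite /e; field.
rewrite ba in le1.
have I0 : (0 <= \int[l1]_(t in `[a, b]) (H t)%:E)%E.
  by apply: integral_ge0 => t _; rewrite lee_fin.
case: (integral _ _ _) le1 I0 => [r le1 r0|_ _|_ /=]; last 2 first.
- exact: leey.
- by rewrite leeNy_eq.
move: le1 r0; rewrite -EFinM -EFinD !lee_fin => le1 r0.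
rewrite (_ : (2 * (b - a)) ^- 2 = e ^+ 2); last by rewrite /e exprVn.
rewrite -(ler_pM2l (_ : 0 < e ^- 2)) ?invr_gt0 ?exprn_gt0//.
rewrite mulrA mulVf ?mul1r; last by rewrite gt_eqF// exprn_gt0.
lra.
Qed.

Lemma derivable_row3 (g : 'rV[R]_3 -> R) (a b t : R) :
  derivable g (row3 a b t) (delta_mx ord0 2) ->
  is_derive (t : R) 1 (fun s => g (row3 a b s)) (partial 2 g (row3 a b t)).
Proof.
move=> dg; rewrite /partial /derive.
have E (h : R) : row3 a b (h *: (1 : R) + t) =
    h *: delta_mx ord0 2 + row3 a b t.
  apply/rowP; apply: ord3P;
  by rewrite !mxE /= ?mulr0 ?mulr1 ?add0r// /GRing.scale /= mulr1.
have QE : (fun h : R => h^-1 *: ((g \o shift (row3 a b t))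
      (h *: delta_mx ord0 2) - g (row3 a b t))) =
    (fun h : R => h^-1 *: (((fun s => g (row3 a b s)) \o shift t) (h *: (1 : R))
      - g (row3 a b t))).
  by apply/funext => h /=; rewrite E.
apply: DeriveDef; first by move: dg; rewrite /derivable QE.
by rewrite /derive QE.
Qed.

Lemma ge_integral_segment (f : measurableTypeR R -> \bar R) (a c : R) :
  0 <= c -> measurable_fun setT f -> (forall x, (0 <= f x)%E) ->
  (forall x, a <= x <= a + 1 -> (c%:E <= f x)%E) ->
  (c%:E <= \int[l1]_x f x)%E.
Proof.
move=> c0 mf f0 cf.
have mI : measurable (`[a, a + 1]%classic : set (measurableTypeR R)).
  exact: measurable_itv.
apply: (@le_trans _ _ (\int[l1]_(x in `[a, (a + 1)%R]) f x)%E); last first.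
  exact: ge0_subset_integral.
have -> : (c%:E = \int[l1]_(x in `[a, (a + 1)%R]) (cst c%:E x))%E.
  rewrite integral_cst//= lebesgue_measure_itv/= lte_fin ltrDl ltr01.
  by rewrite -EFinB addrAC subrr add0r mule1.
apply: ge0_le_integral => //.
- exact: measurable_funS mf.
Qed.

(** The infimum of the energies is bounded below because every vertical line
    through the box carries a growth by 1 of the test functions. *)
Lemma box_capacity_gt0 (a : R) (F : set 'rV[R]_3) :
  [set x : 'rV[R]_3 | forall i, a <= x ord0 i <= a + 1] `<=` F ->
  ~ compact_cap_zero F.
Proof.
move=> boxF [A [oA bA FA capF]].
have [K [Ka KA]] : exists K : R, - K < a /\
    forall x, A x -> forall i, `|x ord0 i| < K.
  have [M [_ MA]] := bA.
  have M1 : M < `|M| + 1 + `|a|.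
    have := ler_norm M; have := normr_ge0 a; lra.
  exists (`|M| + 1 + `|a| + 1); split.
    by have := ler_norm (- a); rewrite normrN; have := normr_ge0 M; lra.
  move=> x Ax i; have := MA _ M1 x Ax => /=.
  rewrite [`|x|]mx_normrE => /bigmax_leP[_ /(_ (ord0, i) isT)] /=; lra.
have Ka0 : 0 < a + K by lra.
pose c : R := (2 * (a + K)) ^- 2 / 2.
have c0 : 0 < c by rewrite divr_gt0// invr_gt0 exprn_gt0// mulr_gt0.
suff : (c%:E <= condenser_capacity A F)%E.
  by rewrite capF lee_fin leNgt c0.
apply: le_ereal_inf_tmp => _ [g [[gs _ gA] gF] <-].
have g0 (x : 'rV[R]_3) i : K <= `|x ord0 i| -> g x = 0.
  move=> Kx; apply: contrapT => /eqP gx.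
  have /KA/(_ i) : A x by apply: gA; exact: subset_closure.
  by rewrite ltNge Kx.
have cgrad := smooth_continuous_energy gs.
have mG := continuous_measurable_row3 cgrad.
pose G (p : measurableTypeR R * measurableTypeR R * measurableTypeR R) : \bar R :=
  (enorm (grad g (row3 p.1.1 p.1.2 p.2)) ^+ 3)%:E.
have G0 p : (0 <= G p)%E by rewrite lee_fin exprn_ge0// enorm_ge0.
have mG' : measurable_fun setT G by exact/measurable_EFinP.
have -> : conformal_energy g = (\int[l1]_x \int[l1]_y \int[l1]_t G (x, y, t))%E.
  exact: (@fubini3 _ _ _ l1 G).
have mF := measurable_fun_fubini_tonelli_F (m2 := l1) G mG' G0.
have F0 p : (0 <= fubini_F l1 G p)%E by exact: integral_ge0.
apply: (ge_integral_segment (a := a)) => //.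
- exact: ltW.
- exact: (measurable_fun_fubini_tonelli_F (m2 := l1) _ mF F0).
- by move=> x; apply: integral_ge0 => y _; exact: F0.
move=> x xa; suff cF y : a <= y <= a + 1 -> (c%:E <= fubini_F l1 G (x, y))%E.
  exact: (ge_integral_segment (ltW c0) (measurable_fun_pair2 x mF)
    (fun y => F0 (x, y)) cF).
move=> ya.
have gd t : is_derive (t : R) 1 (fun s => g (row3 x y s))
    (partial 2 g (row3 x y t)).
  by apply: derivable_row3; have [_] := gs [::]; exact.
have crow : continuous (row3 x y : R -> 'rV[R]_3).
  have -> : row3 x y = (fun s => s *: delta_mx ord0 2 + row3 x y 0).
    apply/funext => s; apply/rowP; apply: ord3P;
    by rewrite !mxE /= ?mulr0 ?mulr1 ?add0r ?addr0.
  by move=> t; apply: cvgD; [exact: scalel_continuous|exact: cvg_cst].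
rewrite /c -[X in a + X]opprK.
apply: (@line_energy (fun s => g (row3 x y s))
   (fun s => partial 2 g (row3 x y s))
   (fun s => enorm (grad g (row3 x y s)) ^+ 3)) => //.
- by have [cp _] := gs [:: 2] => t; apply: cvg_comp; [exact: crow|exact: cp].
- by move=> t; exact: (continuous_comp (crow t) (cgrad _)).
- move=> t; rewrite lerXn2r// ?nnegrE ?enorm_ge0//.
  by have := coord_le_enorm (grad g (row3 x y t)) 2; rewrite mxE.
- by apply: (@g0 _ 2); rewrite row3E normrN ler_norm.
- by apply: gF; apply: boxF; apply: ord3P; rewrite row3E// lexx lerDl ler01.
Qed.

End Capacity_box.

(** * Smooth functions of one and of three variables *)

Section Smooth.
Variable R : realType.

Fixpoint diff_times (n : nat) (f : R -> R) : Prop :=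
  if n is k.+1 then
    exists2 df, (forall t, is_derive (t : R) 1 f (df t)) & diff_times k df
  else True.

Definition smooth1 (f : R -> R) := forall n, diff_times n f.

Lemma diff_timesW n f : diff_times n.+1 f -> diff_times n f.
Proof.
elim: n f => [//|n ih] f [df fdf dfn] /=.
by exists df => //; exact: ih.
Qed.

Lemma diff_timesD n f g :
  diff_times n f -> diff_times n g -> diff_times n (fun t => f t + g t).
Proof.
elim: n f g => [//|n ih] f g [df fdf dfn] [dg gdg dgn] /=.
exists (fun t => df t + dg t); last exact: ih.
by move=> t; exact: is_deriveD.
Qed.

Lemma diff_timesM n f g :
  diff_times n f -> diff_times n g -> diff_times n (fun t => f t * g t).
Proof.
elim: n f g => [//|n ih] f g fn gn.
have := fn => -[df fdf dfn]; have := gn => -[dg gdg dgn].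
exists (fun t => f t * dg t + g t * df t).
  by move=> t; exact: is_deriveM.
by apply: diff_timesD; apply: ih => //; exact: diff_timesW.
Qed.

Lemma diff_times_cst n (c : R) : diff_times n (fun=> c).
Proof.
elim: n c => [//|n ih] c /=.
by exists (fun=> 0) => // t; exact: is_derive_cst.
Qed.

Lemma diff_times_affine n f (a b : R) :
  diff_times n f -> diff_times n (fun t => f (a * t + b)).
Proof.
elim: n f => [//|n ih] f [df fdf dfn].
exists (fun t => df (a * t + b) * a); last first.
  by apply: diff_timesM; [exact: ih|exact: diff_times_cst].
move=> t; have dA : is_derive (t : R) 1 (fun s : R => a * s + b) a.
  have dZ : is_derive t 1 (fun s : R => a * s) (a *: (1 : R)).
    exact: is_deriveZ.
  have := is_deriveD dZ (is_derive_cst b t 1).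
  by rewrite addr0 /GRing.scale /= mulr1.
exact: (@is_derive1_comp _ f _ t _ _ (fdf _) dA).
Qed.

Lemma smooth1_is_derive f t : smooth1 f -> is_derive (t : R) 1 f (derive1 f t).
Proof.
move=> /(_ 1%N)[df fdf _]; rewrite derive1E.
by have := fdf t => h; rewrite (derive_val (is_derive:=h)).
Qed.

Lemma smooth1_derive f : smooth1 f -> smooth1 (derive1 f).
Proof.
move=> fs n; have [df fdf dfn] := fs n.+1.
suff -> : derive1 f = df by [].
by apply/funext => t; rewrite derive1E (derive_val (is_derive:=fdf t)).
Qed.

Lemma smooth1_continuous f : smooth1 f -> continuous f.
Proof.
move=> fs t; apply: differentiable_continuous; apply/derivable1_diffP.
by case: (smooth1_is_derive t fs).
Qed.

(** The derivative of t^-n exp(-1/t) is a combination of the functions with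
    exponents n + 1 and n + 2; treating the whole family at once gives the
    smoothness of exp(-1/t) without any formula for its derivatives. *)
Definition flat (n : nat) (t : R) : R :=
  if 0 < t then t^-1 ^+ n * expR (- t^-1) else 0.

Lemma flat_le n t : 0 < t -> flat n t <= (n.+1)`!%:R * t.
Proof.
move=> t0; rewrite /flat t0 expRN.
have ti0 : 0 < t^-1 by rewrite invr_gt0.
rewrite ler_pdivrMr ?expR_gt0//.
have : t^-1 ^+ n.+1 / n.+1`!%:R <= expR t^-1.
  by apply: le_trans (expR_ge1Dxn n (ltW ti0)); rewrite lerDr.
rewrite ler_pdivrMr ?ltr0n ?fact_gt0// => h.
by rewrite mulrAC -ler_pdivrMr// -exprSr mulrC.
Qed.

Lemma flat_ge0 n t : 0 <= flat n t.
Proof.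
rewrite /flat; case: ifPn => // t0.
by rewrite mulr_ge0 ?expR_ge0// exprn_ge0// invr_ge0 ltW.
Qed.

Lemma is_derive_flat n t :
  is_derive (t : R) 1 (flat n) (- n%:R * flat n.+1 t + flat n.+2 t).
Proof.
have [t0|t0|->] := ltgtP t 0.
- have -> : - n%:R * flat n.+1 t + flat n.+2 t = 0.
    by rewrite /flat !ltNge (ltW t0) /= mulr0 addr0.
  apply: (@near_eq_is_derive _ _ _ (cst 0)).
  near=> s; rewrite /flat/= ltNge.
  by have /ltW -> : s < 0 by near: s; exact: lt_nbhsl.
- have dV : is_derive t 1 (fun s : R => s^-1) (- t ^- 2).
    have := @is_deriveV _ id t 1 1 (lt0r_neq0 t0) (is_derive_id _ _).
    by rewrite /GRing.scale /= mulr1.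
  have dE : is_derive t 1 (fun s : R => expR (- s^-1))
      (expR (- t^-1) * (t ^- 2)).
    apply: (@is_derive1_comp _ expR (fun s => - s^-1)).
    by have := is_deriveN dV; rewrite opprK.
  have dX : is_derive t 1 (fun s : R => s^-1 ^+ n)
      (n%:R * t^-1 ^+ n.-1 *: (- t ^- 2)).
    have -> : (fun s : R => s^-1 ^+ n) = (fun s : R => s^-1) ^+ n.
      by apply/funext => s; elim: n {dE} => [|k ih] //; rewrite !exprS ih.
    exact: (@is_deriveX _ _ _ n _ _ _ dV).
  have := is_deriveM dX dE.
  set a := (X in is_derive _ _ _ X -> _) => h.
  suff <- : a = - n%:R * flat n.+1 t + flat n.+2 t.
    apply: (near_eq_is_derive _ h); near=> s; rewrite /flat.
    by have -> : 0 < s by near: s; exact: lt_nbhsr.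
  rewrite /a /flat t0 /GRing.scale /= -!exprVn.
  move: (t^-1) (expR _) => u e.
  by case: n {h a dX} => [|n] /=; rewrite ?exprS; ring.
- have -> : - n%:R * flat n.+1 0 + flat n.+2 0 = 0 :> R.
    by rewrite /flat ltxx mulr0 addr0.
  suff : (fun h : R => h^-1 *: ((flat n \o shift (0 : R)) (h *: (1 : R)) - flat n 0))
      @ (0 : R)^' --> (0 : R).
    move=> h; apply: DeriveDef; first by apply/cvg_ex; exists 0.
    by rewrite /derive; apply/cvg_lim.
  apply/cvgr0Pnorm_lt => eps eps0.
  near=> h.
  rewrite /= /shift /= addr0 /GRing.scale /= mulr1 {2}/flat ltxx subr0.
  have [h0|h0] := ltP 0 h; last first.
    by rewrite {1}/flat ifF ?mulr0 ?normr0// ltNge h0.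
  have -> : h^-1 * flat n h = flat n.+1 h.
    by rewrite /flat h0 exprS mulrA.
  rewrite ger0_norm ?flat_ge0//; apply: (le_lt_trans (flat_le _ h0)).
  rewrite mulrC -ltr_pdivlMr ?ltr0n ?fact_gt0//.
  apply: (le_lt_trans (ler_norm _)); near: h.
  by apply: dnbhs0_lt; rewrite divr_gt0 ?ltr0n ?fact_gt0.
Unshelve. all: by end_near.
Qed.

Lemma smooth1_flat n : smooth1 (flat n).
Proof.
move=> k; elim: k n => [//|k ih] n /=.
exists (fun t => - n%:R * flat n.+1 t + flat n.+2 t).
  exact: is_derive_flat.
apply: diff_timesD => //; apply: diff_timesM => //; exact: diff_times_cst.
Qed.

(** Normalised by its value at 0, which the capacity of a point requires to be
    at least 1. *)
Definition bump (t : R) : R :=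
  (flat 0 1 ^+ 2)^-1 * (flat 0 (-1 * t + 1) * flat 0 (1 * t + 1)).

Lemma smooth1_bump : smooth1 bump.
Proof.
move=> n; apply: diff_timesM; first exact: diff_times_cst.
by apply: diff_timesM; apply: diff_times_affine; exact: smooth1_flat.
Qed.

Lemma bump0 : bump 0 = 1.
Proof.
rewrite /bump !mulr0 add0r -expr2 mulVf// expf_neq0//.
by rewrite /flat ltr01 invr1 expr0 mul1r gt_eqF// expR_gt0.
Qed.

Lemma bump_out t : 1 <= `|t| -> bump t = 0.
Proof.
rewrite ler_normr => /orP[t1|t1]; rewrite /bump /flat.
  have -> : (0 < -1 * t + 1) = false by apply/negbTE; rewrite -leNgt; lra.
  by rewrite mul0r mulr0.
have -> : (0 < 1 * t + 1) = false by apply/negbTE; rewrite -leNgt; lra.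
by rewrite !mulr0.
Qed.

End Smooth.

(** * A point has zero conformal capacity *)

Section Tensor.
Variable R : realType.

Definition prod3 (a b c : R -> R) (x : 'rV[R]_3) : R :=
  a (x ord0 0) * (b (x ord0 1) * c (x ord0 2)).

(** A class of smooth functions of three variables that is visibly closed under
    [partial], so that smoothness needs no induction on multi-indices. *)
Inductive tensor : ('rV[R]_3 -> R) -> Prop :=
| tensor_prod3 a b c : smooth1 a -> smooth1 b -> smooth1 c -> tensor (prod3 a b c)
| tensor_add f g : tensor f -> tensor g -> tensor (fun x => f x + g x).

Lemma is_derive_coord (a : R -> R) (x : 'rV[R]_3) (i j : 'I_3) : smooth1 a ->
  is_derive x (delta_mx ord0 i) (fun y : 'rV[R]_3 => a (y ord0 j))
    ((j == i)%:R * derive1 a (x ord0 j)).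
Proof.
move=> /(smooth1_is_derive (x ord0 j))[da aE].
pose Q (h : R) := h^-1 *: (((fun y : 'rV[R]_3 => a (y ord0 j)) \o shift x)
  (h *: delta_mx ord0 i) - a (x ord0 j)).
suff [cQ lQ] : cvg (Q h @[h --> 0^']) /\
    lim (Q h @[h --> 0^']) = (j == i)%:R * derive1 a (x ord0 j).
  exact: DeriveDef.
have [ji|ji] := eqVneq j i; last first.
  have -> : Q = cst 0.
    apply/funext => h; rewrite /Q /= !mxE /= ?eqxx /= (negbTE ji) mulr0 add0r.
    by rewrite subrr scaler0.
  split; first exact: is_cvg_cst.
  by rewrite mul0r; apply: cvg_lim => //; exact: cvg_cst.
have -> : Q = fun h : R => h^-1 *: ((a \o shift (x ord0 j)) (h *: (1 : R))
    - a (x ord0 j)).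
  by apply/funext => h; rewrite /Q /= !mxE /= ji !eqxx.
by rewrite mul1r; split; [exact: da|exact: aE].
Qed.

Lemma is_derive_prod3 a b c (x : 'rV[R]_3) i :
  smooth1 a -> smooth1 b -> smooth1 c ->
  is_derive x (delta_mx ord0 i) (prod3 a b c)
    (prod3 (fun t => ((0 : 'I_3) == i)%:R * derive1 a t) b c x +
     prod3 a (fun t => ((1 : 'I_3) == i)%:R * derive1 b t) c x +
     prod3 a b (fun t => ((2 : 'I_3) == i)%:R * derive1 c t) x).
Proof.
move=> sa sb sc.
have da := is_derive_coord x i 0 sa.
have db := is_derive_coord x i 1 sb.
have dc := is_derive_coord x i 2 sc.
have := is_deriveM da (is_deriveM db dc).
set d := (X in is_derive _ _ _ X -> _) => h.
suff <- : d = prod3 (fun t => ((0 : 'I_3) == i)%:R * derive1 a t) b c x +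
     prod3 a (fun t => ((1 : 'I_3) == i)%:R * derive1 b t) c x +
     prod3 a b (fun t => ((2 : 'I_3) == i)%:R * derive1 c t) x by exact: h.
rewrite /d /prod3 /GRing.scale /=.
have -> : ((fun y : 'rV[R]_3 => b (y ord0 1)) * (fun y => c (y ord0 2))) x =
  b (x ord0 1) * c (x ord0 2) by [].
ring.
Qed.

Lemma smooth1Z (k : R) (a : R -> R) : smooth1 a -> smooth1 (fun t => k * a t).
Proof. by move=> sa n; apply: diff_timesM => //; exact: diff_times_cst. Qed.

Lemma tensor_derivable f (x : 'rV[R]_3) i :
  tensor f -> derivable f x (delta_mx ord0 i).
Proof.
elim=> [a b c sa sb sc|{}f g _ df _ dg]; last exact: derivableD.
by case: (is_derive_prod3 x i sa sb sc).
Qed.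

Lemma partialD (f g : 'rV[R]_3 -> R) i x :
  derivable f x (delta_mx ord0 i) -> derivable g x (delta_mx ord0 i) ->
  partial i (fun y => f y + g y) x = partial i f x + partial i g x.
Proof. by move=> df dg; rewrite /partial deriveD. Qed.

Lemma tensor_partial f i : tensor f -> tensor (partial i f).
Proof.
elim=> [a b c sa sb sc|{}f g tf tdf tg tdg]; last first.
  suff -> : partial i (fun x => f x + g x) = fun x => partial i f x + partial i g x.
    exact: tensor_add.
  by apply/funext => x; rewrite partialD//; exact: tensor_derivable.
set k := fun j : 'I_3 => (j == i)%:R : R.
suff -> : partial i (prod3 a b c) = fun x =>
    (prod3 (fun t => k 0 * derive1 a t) b c x +
     prod3 a (fun t => k 1 * derive1 b t) c x +
     prod3 a b (fun t => k 2 * derive1 c t) x).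
  have sda := smooth1_derive sa; have sdb := smooth1_derive sb.
  have sdc := smooth1_derive sc.
  exact: (tensor_add (tensor_add
    (tensor_prod3 (smooth1Z (k 0) sda) sb sc)
    (tensor_prod3 sa (smooth1Z (k 1) sdb) sc))
    (tensor_prod3 sa sb (smooth1Z (k 2) sdc))).
by apply/funext => x; rewrite /partial (derive_val (is_derive:=is_derive_prod3 x i sa sb sc)).
Qed.

Lemma tensor_continuous f : tensor f -> continuous f.
Proof.
have co (d : R -> R) j : smooth1 d -> continuous (fun y : 'rV[R]_3 => d (y ord0 j)).
  move=> sd x; apply: (@continuous_comp _ _ _ (fun y : 'rV[R]_3 => y ord0 j) d).
    exact: coord_continuous.
  exact: smooth1_continuous.
elim=> [a b c sa sb sc|{}f g _ cf _ cg]; last exact: continuous_add.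
by apply: continuous_mul; [exact: co|apply: continuous_mul; exact: co].
Qed.

Lemma tensor_smooth f : tensor f -> smooth f.
Proof.
move=> tf s; suff : tensor (foldr partial f s).
  by move=> ts; split=> [|i x]; [exact: tensor_continuous|exact: tensor_derivable].
by elim: s => //= i s; exact: tensor_partial.
Qed.

End Tensor.

Section Capacity_point.
Variable R : realType.
Notation l1 := (@lebesgue_measure R).

Lemma bump_bounds : exists2 K : R, 0 < K & forall t : R,
  `|bump t| <= K * (`|t| <= 1)%R%:R /\ `|derive1 (@bump R) t| <= K * (`|t| <= 1)%R%:R.
Proof.
have bounded (f : R -> R) : continuous f -> exists M, forall t, `|t| <= 1 -> `|f t| <= M.
  move=> cf; have nf : {within `[-1, 1], continuous (fun t => `|f t|)}.
    apply: continuous_subspaceT => t.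
    by apply: (@continuous_comp _ _ _ f Num.norm); [exact: cf|exact: norm_continuous].
  have N11 : -1 <= 1 :> R by lra.
  have [c _ fc] := EVT_max N11 nf.
  by exists `|f c| => t t1; apply: fc; rewrite in_itv /= -ler_norml.
have sb := smooth1_bump R; have sdb := smooth1_derive sb.
have [M1 fM1] := bounded _ (smooth1_continuous sb).
have [M2 fM2] := bounded _ (smooth1_continuous sdb).
have M10 : 0 <= M1 by apply: le_trans (fM1 0 _); rewrite ?normr0.
have M20 : 0 <= M2 by apply: le_trans (fM2 0 _); rewrite ?normr0.
exists (M1 + M2 + 1); first lra.
move=> t; have [t1|t1] := leP `|t| 1.
  by rewrite mulr1; have := fM1 _ t1; have := fM2 _ t1; split; lra.
rewrite mulr0 bump_out ?normr0; last exact: ltW.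
split=> //; suff -> : derive1 (@bump R) t = 0 by rewrite normr0.
rewrite derive1E; apply: derive_val.
apply: (@near_eq_is_derive _ _ _ (cst 0)).
near=> s; rewrite bump_out//; apply: ltW; near: s.
by apply: (cvgr_gt `|t|) => //; exact: norm_continuous.
Unshelve. all: by end_near.
Qed.

Definition wave (k : nat) (t : R) : R := bump (2 ^+ k * t).

Lemma smooth1_wave k : smooth1 (wave k).
Proof.
move=> n; have := diff_times_affine (2 ^+ k) 0 (@smooth1_bump R n).
by under eq_fun do rewrite addr0.
Qed.

Lemma derive1_wave k t : derive1 (wave k) t = 2 ^+ k * derive1 (@bump R) (2 ^+ k * t).
Proof.
rewrite derive1E; apply: derive_val.
rewrite mulrC; apply: (@is_derive1_comp _ (@bump R) (fun t => 2 ^+ k * t)).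
  exact: smooth1_is_derive (smooth1_bump _).
have : is_derive t 1 (fun s : R => 2 ^+ k * s) ((2 ^+ k) *: (1 : R)).
  exact: is_deriveZ.
by rewrite /GRing.scale /= mulr1.
Qed.

(** The conformal energy of a bump does not depend on its scale, and the energies
    of bumps at different scales hardly interact: for c = 1 / N this average of
    N bumps has value 1 at 0 and energy of the order of 1 / N^2. *)
Definition spike (c : R) (N : nat) (x : 'rV[R]_3) : R :=
  \sum_(k < N) prod3 (fun t => c * wave k t) (wave k) (wave k) x.

Definition cube (k : nat) (x : 'rV[R]_3) : bool :=
  [forall j, `|2 ^+ k * x ord0 j| <= 1].

Lemma cubeE k (x : 'rV[R]_3) : cube k x = [&& `|2 ^+ k * x ord0 0| <= 1,
  `|2 ^+ k * x ord0 1| <= 1 & `|2 ^+ k * x ord0 2| <= 1].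
Proof.
apply/forallP/and3P => [h|[h0 h1 h2]]; first by split; exact: h.
exact: ord3P.
Qed.

Lemma spike_tensor c N : tensor (spike c N).
Proof.
elim: N => [|N ih].
  have -> : spike c 0 = prod3 (fun=> 0) (fun=> 0) (fun=> 0).
    by apply/funext => x; rewrite /spike big_ord0 /prod3 mul0r.
  by apply: tensor_prod3 => n; exact: diff_times_cst.
have -> : spike c N.+1 = fun x => spike c N x +
    prod3 (fun t => c * wave N t) (wave N) (wave N) x.
  by apply/funext => x; rewrite /spike big_ord_recr.
apply: (tensor_add ih (tensor_prod3 _ _ _)); last 2 first.
- exact: smooth1_wave.
- exact: smooth1_wave.
- exact: smooth1Z (smooth1_wave _).
Qed.

Lemma prod3_le (a b c : R -> R) (A B C : R) (ea eb ec : bool) (x : 'rV[R]_3) :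
  0 <= A -> 0 <= B -> 0 <= C ->
  `|a (x ord0 0)| <= A * ea%:R -> `|b (x ord0 1)| <= B * eb%:R ->
  `|c (x ord0 2)| <= C * ec%:R ->
  `|prod3 a b c x| <= A * (B * C) * [&& ea, eb & ec]%:R.
Proof.
move=> A0 B0 C0 ha hb hc; rewrite /prod3 !normrM.
apply: (@le_trans _ _ ((A * ea%:R) * ((B * eb%:R) * (C * ec%:R)))).
  by rewrite ler_pM ?mulr_ge0// ler_pM.
by case: ea {ha}; case: eb {hb}; case: ec {hc};
  rewrite /= ?mulr0 ?mul0r ?mulr0 ?mulr1.
Qed.

Lemma partial_wave_le (K c : R) k i (x : 'rV[R]_3) : 0 <= c -> 0 < K ->
  (forall t : R, `|bump t| <= K * (`|t| <= 1)%R%:R /\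
     `|derive1 (@bump R) t| <= K * (`|t| <= 1)%R%:R) ->
  `|partial i (prod3 (fun t => c * wave k t) (wave k) (wave k)) x| <=
  c * K ^+ 3 * (2 ^+ k * (cube k x)%:R).
Proof.
move=> c0 K0 bK.
have w j : `|wave k (x ord0 j)| <= K * (`|2 ^+ k * x ord0 j| <= 1)%R%:R.
  exact: (bK _).1.
have dw j : `|derive1 (wave k) (x ord0 j)| <=
    (2 ^+ k * K) * (`|2 ^+ k * x ord0 j| <= 1)%R%:R.
  rewrite derive1_wave normrM normrX normr_nat -mulrA ler_wpM2l//.
  exact: (bK _).2.
have cw j : `|c * wave k (x ord0 j)| <=
    (c * K) * (`|2 ^+ k * x ord0 j| <= 1)%R%:R.
  by rewrite normrM ger0_norm// -mulrA ler_wpM2l.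
have cdw j : `|c * derive1 (wave k) (x ord0 j)| <=
    (c * (2 ^+ k * K)) * (`|2 ^+ k * x ord0 j| <= 1)%R%:R.
  by rewrite normrM ger0_norm// -mulrA ler_wpM2l.
have sw := smooth1_wave k; have scw := smooth1Z c sw.
have dcw t : derive1 (fun t => c * wave k t) t = c * derive1 (wave k) t.
  rewrite derive1E; apply: derive_val.
  exact: (@is_deriveZ _ _ _ (wave k) c _ _ _ (smooth1_is_derive _ sw)).
have K0' := ltW K0; have k0 : 0 <= 2 ^+ k :> R by rewrite exprn_ge0.
rewrite /partial (derive_val (is_derive:=is_derive_prod3 x i scw sw sw)).
have z (b d : R -> R) : (prod3 (fun t => 0 * b t) d d x = 0)
    * (prod3 (fun t => c * d t) (fun t => 0 * b t) d x = 0)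
    * (prod3 (fun t => c * d t) d (fun t => 0 * b t) x = 0).
  by rewrite /prod3 !(mul0r, mulr0).
rewrite cubeE; set e := [&& _, _ & _].
move: i; apply: ord3P; rewrite !eqxx /= !z ?addr0 ?add0r.
- have -> : c * K ^+ 3 * (2 ^+ k * e%:R) =
    (c * (2 ^+ k * K)) * (K * K) * e%:R by ring.
  by apply: prod3_le => //; rewrite ?mul1r ?dcw ?mulr_ge0.
- have -> : c * K ^+ 3 * (2 ^+ k * e%:R) =
    (c * K) * ((2 ^+ k * K) * K) * e%:R by ring.
  by apply: prod3_le => //; rewrite ?mul1r ?mulr_ge0.
- have -> : c * K ^+ 3 * (2 ^+ k * e%:R) =
    (c * K) * (K * (2 ^+ k * K)) * e%:R by ring.
  by apply: prod3_le => //; rewrite ?mul1r ?mulr_ge0.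
Qed.

End Capacity_point.

Section Capacity_point.
Variable R : realType.
Notation l1 := (@lebesgue_measure R).
Notation T3 := (measurableTypeR R * measurableTypeR R * measurableTypeR R)%type.

(** A sum of distinct powers of 2 is at most twice its largest term, so that its
    cube is controlled by the cubes of its terms. *)
Lemma sum_cubes_le N (x : 'rV[R]_3) :
  (\sum_(k < N) 2 ^+ k * (cube k x)%:R) ^+ 3 <=
  8 * (\sum_(k < N) 8 ^+ k * (cube k x)%:R) :> R.
Proof.
have S0 M (b : R) : 0 <= b -> 0 <= \sum_(k < M) b ^+ k * (cube k x)%:R.
  by move=> b0; apply: sumr_ge0 => k _; rewrite mulr_ge0// exprn_ge0.
have S2 M : \sum_(k < M) 2 ^+ k * (cube k x)%:R <= 2 ^+ M :> R.
  elim: M => [|M ih]; first by rewrite big_ord0 ler01.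
  rewrite big_ord_recr /= exprS mulrDl mul1r lerD//.
  by rewrite ler_piMr ?exprn_ge0// lern1 leq_b1.
elim: N => [|N ih]; first by rewrite !big_ord0 mulr0 expr0n.
rewrite !big_ord_recr /=; case: (boolP (cube N x)) => xN; last first.
  by rewrite !mulr0 !addr0.
rewrite !mulr1.
have le2 : \sum_(k < N) 2 ^+ k * (cube k x)%:R + 2 ^+ N <= 2 * 2 ^+ N :> R.
  by rewrite mulrDl mul1r lerD2r.
apply: (@le_trans _ _ ((2 * 2 ^+ N) ^+ 3)).
  by rewrite lerXn2r// ?nnegrE ?addr_ge0 ?mulr_ge0 ?exprn_ge0// S0.
have -> : (2 * 2 ^+ N) ^+ 3 = 8 * 8 ^+ N :> R.
  by rewrite -exprS -exprM mulnC exprM -exprS; congr (_ ^+ _); ring.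
by rewrite ler_pM2l// lerDr S0.
Qed.

Lemma partial_spike c N i (x : 'rV[R]_3) : partial i (spike c N) x =
  \sum_(k < N) partial i (prod3 (fun t => c * wave k t) (@wave R k) (@wave R k)) x.
Proof.
elim: N => [|N ih].
  have -> : spike c 0 = cst 0 by apply/funext => y; rewrite /spike big_ord0.
  by rewrite big_ord0 /partial derive_cst.
have -> : spike c N.+1 = fun x => spike c N x +
    prod3 (fun t => c * wave N t) (@wave R N) (@wave R N) x.
  by apply/funext => y; rewrite /spike big_ord_recr.
rewrite partialD ?ih ?big_ord_recr//; apply: tensor_derivable.
  exact: spike_tensor.
have sw := @smooth1_wave R N.
exact: (tensor_prod3 (smooth1Z c sw) sw sw).
Qed.

Lemma spike_energy_density (K c : R) N (x : 'rV[R]_3) : 0 <= c -> 0 < K ->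
  (forall t : R, `|bump t| <= K * (`|t| <= 1)%R%:R /\
     `|derive1 (@bump R) t| <= K * (`|t| <= 1)%R%:R) ->
  enorm (grad (spike c N) x) ^+ 3 <=
    \sum_(k < N) 8 * (3 * (c * K ^+ 3)) ^+ 3 * 8 ^+ k * (cube k x)%:R.
Proof.
move=> c0 K0 bK.
set S : R := \sum_(k < N) 2 ^+ k * (cube k x)%:R.
have S0 : 0 <= S by apply: sumr_ge0 => k _; rewrite mulr_ge0// exprn_ge0.
have D0 : 0 <= c * K ^+ 3 by rewrite mulr_ge0// exprn_ge0// ltW.
have pS i : `|partial i (spike c N) x| <= c * K ^+ 3 * S.
  rewrite partial_spike; apply: (le_trans (ler_norm_sum _ _ _)).
  by rewrite mulr_sumr; apply: ler_sum => k _; exact: partial_wave_le.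
have nS : enorm (grad (spike c N) x) <= 3 * (c * K ^+ 3) * S.
  have gE i : grad (spike c N) x ord0 i = partial i (spike c N) x by rewrite mxE.
  apply: (le_trans (enorm_le_sum3 _)); rewrite !gE.
  apply: (le_trans (lerD (lerD (pS 0) (pS 1)) (pS 2))).
  by rewrite le_eqVlt; apply/orP; left; apply/eqP; ring.
apply: (@le_trans _ _ ((3 * (c * K ^+ 3) * S) ^+ 3)).
  have r0 : 0 <= 3 * (c * K ^+ 3) * S by rewrite mulr_ge0// mulr_ge0.
  by rewrite lerXn2r// nnegrE ?enorm_ge0.
rewrite exprMn; apply: (@le_trans _ _ ((3 * (c * K ^+ 3)) ^+ 3 *
    (8 * (\sum_(k < N) 8 ^+ k * (cube k x)%:R)))).
  by rewrite ler_wpM2l ?sum_cubes_le// exprn_ge0// mulr_ge0.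
rewrite mulrA mulr_sumr; apply: ler_sum => k _.
by rewrite le_eqVlt; apply/orP; left; apply/eqP; ring.
Qed.

Definition box3 (k : nat) : set T3 :=
  (`[- (2 ^- k) : R, 2 ^- k]%classic `*` `[- (2 ^- k) : R, 2 ^- k]%classic)
    `*` `[- (2 ^- k) : R, 2 ^- k]%classic.

Lemma measurable_box3 k : measurable (box3 k).
Proof. by do 2 (apply: measurableX => //); exact: measurable_itv. Qed.

Lemma cube_box3 k (p : T3) : (cube k (row3 p.1.1 p.1.2 p.2))%:R = \1_(box3 k) p :> R.
Proof.
rewrite indicE; congr (_%:R); congr nat_of_bool.
have i2 (t : R) : (`|2 ^+ k * t| <= 1) = (t \in `[- (2 ^- k) : R, 2 ^- k]).
  rewrite normrM normrX normr_nat -ler_pdivlMl ?exprn_gt0// mulr1.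
  by rewrite in_itv /= ler_norml.
rewrite cubeE !row3E !i2; apply/idP/idP.
  by move=> /and3P[h0 h1 h2]; rewrite inE.
by rewrite inE => -[[h0 h1] h2]; apply/and3P.
Qed.

Lemma lebesgue3_box3 k : @lebesgue3 R (box3 k) = (8 * 8 ^- k)%:E.
Proof.
have I2 : l1 (`[- (2 ^- k) : R, 2 ^- k]%classic) = (2 * 2 ^- k)%:E.
  rewrite lebesgue_measure_itv/= lte_fin gtrN ?invr_gt0 ?exprn_gt0//.
  by rewrite -EFinB opprK mulrDl mul1r.
rewrite /lebesgue3 /lebesgue2 product_measure1E; last 2 first.
- by apply: measurableX; exact: measurable_itv.
- exact: measurable_itv.
rewrite /= product_measure1E; [|exact: measurable_itv..].
transitivity ((2 * 2 ^- k)%:E * (2 * 2 ^- k)%:E * (2 * 2 ^- k)%:E : \bar R)%E.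
  by congr (_ * _ * _)%E; exact: I2.
rewrite -!EFinM; congr EFin.
have -> : 8 ^+ k = 2 ^+ k * 2 ^+ k * 2 ^+ k :> R.
  by rewrite -!exprMn; congr (_ ^+ _); ring.
have : 2 ^+ k != 0 :> R by rewrite expf_neq0.
by move=> k0; field.
Qed.

Lemma spike_energy (K c : R) N : 0 <= c -> 0 < K ->
  (forall t : R, `|bump t| <= K * (`|t| <= 1)%R%:R /\
     `|derive1 (@bump R) t| <= K * (`|t| <= 1)%R%:R) ->
  (conformal_energy (spike c N) <=
    (64 * (3 * (c * K ^+ 3)) ^+ 3 * N%:R)%:E)%E.
Proof.
move=> c0 K0 bK.
set D : R := 8 * (3 * (c * K ^+ 3)) ^+ 3.
have D0 : 0 <= D.
  by rewrite mulr_ge0// exprn_ge0// mulr_ge0// mulr_ge0// exprn_ge0// ltW.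
pose f (k : 'I_N) (p : T3) : \bar R := (D * 8 ^+ k * \1_(box3 k) p)%:E.
have mf k : measurable_fun setT (f k).
  apply/measurable_EFinP; apply: measurable_funM => //.
  by apply: measurable_indic; exact: measurable_box3.
have f0 k p : (0 <= f k p)%E.
  by rewrite lee_fin mulr_ge0// mulr_ge0// exprn_ge0.
have mg : measurable_fun setT (fun p : T3 =>
    (enorm (grad (spike c N) (row3 p.1.1 p.1.2 p.2)) ^+ 3)%:E).
  apply/measurable_EFinP; apply: (continuous_measurable_row3
    (g := fun x => enorm (grad (spike c N) x) ^+ 3)).
  exact/smooth_continuous_energy/tensor_smooth/spike_tensor.
apply: (@le_trans _ _ (\int[@lebesgue3 R]_p (\sum_(k < N) f k p))%E).
  apply: (@ge0_le_integral _ T3 R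
    (@product_measure1 _ _ _ _ _ (l1 \x l1)%E l1)) => //.
  - by move=> p _; rewrite lee_fin exprn_ge0// enorm_ge0.
  - exact: emeasurable_sum.
  - move=> p _; rewrite sumEFin lee_fin.
    apply: (le_trans (spike_energy_density _ _ c0 K0 bK)).
    by rewrite le_eqVlt; apply/orP; left; apply/eqP;
      apply: eq_bigr => k _; rewrite cube_box3.
rewrite (@ge0_integral_sum _ T3 R
    (@product_measure1 _ _ _ _ _ (l1 \x l1)%E l1) setT measurableT _ f)//.
have fE k : (\int[@lebesgue3 R]_p f k p = (8 * D)%:E)%E.
  rewrite /f; under eq_integral do rewrite EFinM.
  rewrite (@ge0_integralZl_EFin _ T3 R
    (@product_measure1 _ _ _ _ _ (l1 \x l1)%E l1) setT measurableT)//.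
  - rewrite (@integral_indic _ T3 R
      (@product_measure1 _ _ _ _ _ (l1 \x l1)%E l1))//; last first.
      exact: measurable_box3.
    rewrite setIT; transitivity ((D * 8 ^+ k)%:E * @lebesgue3 R (box3 k))%E.
      by [].
    rewrite lebesgue3_box3 -EFinM; congr EFin.
    have k0 : 8 ^+ k != 0 :> R by rewrite expf_neq0.
    by field.
  - by apply/measurable_EFinP; apply: measurable_indic; exact: measurable_box3.
  - by rewrite mulr_ge0// exprn_ge0.
rewrite (eq_bigr (fun=> (8 * D)%:E)); last by move=> k _; exact: fE.
rewrite sumEFin lee_fin sumr_const card_ord -mulr_natr.
by rewrite le_eqVlt /D; apply/orP; left; apply/eqP; ring.
Qed.

(** Spikes of arbitrarily small energy are admissible for the origin. *)
Lemma compact_cap_zero_point (F : set 'rV[R]_3) :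
  F `<=` [set 0] -> compact_cap_zero F.
Proof.
move=> F0; have [K K0 bK] := bump_bounds R.
pose A : set 'rV[R]_3 := ball 0 2.
have bA : bounded_set A.
  exists 2; split=> // M M2 x; rewrite /A -ball_normE /= sub0r normrN.
  by move=> /ltW /le_trans; apply; exact: ltW.
exists A; split=> //.
- exact: ball_open.
- by move=> x /F0 ->; exact: ballxx.
apply/eqP; rewrite eq_le; apply/andP; split; last first.
  apply: le_ereal_inf_tmp => _ [g _ <-].
  by apply: integral_ge0 => p _; rewrite lee_fin exprn_ge0// enorm_ge0.
apply/lee_addgt0Pr => e e0; rewrite add0e.
pose D : R := 64 * (3 * K ^+ 3) ^+ 3.
have D0 : 0 < D by rewrite mulr_gt0// exprn_gt0// mulr_gt0// exprn_gt0.
pose N := (Num.truncn (D / e)).+1.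
have N0 : 0 < N%:R :> R by rewrite ltr0n.
have Ne : D / e < N%:R by exact: truncnS_gt.
pose c : R := N%:R^-1.
have c0 : 0 <= c by rewrite invr_ge0 ltW.
apply: ge_ereal_inf; exists (conformal_energy (spike c N)); last first.
  apply: (le_trans (spike_energy N c0 K0 bK)); rewrite lee_fin.
  have -> : 64 * (3 * (c * K ^+ 3)) ^+ 3 * N%:R = D * N%:R^-1 * N%:R^-1.
    rewrite /D /c; have := lt0r_neq0 N0 => n0; by field.
  have De : D * N%:R^-1 <= e.
    by rewrite ler_pdivrMr// mulrC -ler_pdivrMr// ltW.
  apply: (le_trans _ De); rewrite -[leRHS]mulr1 ler_wpM2l//.
    by rewrite mulr_ge0// ?invr_ge0 ltW.
  by rewrite invf_le1// ler1n.
exists (spike c N) => //; split; last first.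
  move=> x /F0 ->; rewrite /spike (eq_bigr (fun=> c)); last first.
    by move=> k _; rewrite /prod3 /wave !mxE mulr0 bump0 !mulr1.
  by rewrite sumr_const card_ord -mulr_natr mulVf// lt0r_neq0.
pose B : set 'rV[R]_3 := 
  [set v : 'rV[R]_3 | forall i, v ord0 i \in `[(-1), 1]].
have cB : compact B.
  have := @rV_compact R 3 (fun=> `[(-1), 1]%classic); apply => _.
  exact: segment_compact.
have sB : closure [set x | spike c N x != 0] `<=` B.
  have clB : closed B by apply: compact_closed => //; exact: norm_hausdorff.
  have /closure_id -> := clB; apply: closureS => x /= sx i.
  rewrite /= in_itv /= -ler_norml leNgt; apply: contra_neqN sx => xi.
  apply: big1 => k _; rewrite /prod3 /wave.
  have kx : 1 <= `|2 ^+ k * x ord0 i|.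
    rewrite normrM normrX normr_nat; apply: (le_trans (ltW xi)).
    by rewrite ler_peMl// exprn_ege1// ler1n.
  by move: i kx {xi}; apply: ord3P => /bump_out ->; rewrite ?(mulr0, mul0r).
split.
- exact/tensor_smooth/spike_tensor.
- apply: subclosed_compact cB sB; exact: closed_closure.
- apply: (subset_trans sB) => x Bx; rewrite /A; split=> // i j.
  have := Bx j; rewrite /= in_itv /= -ler_norml => xj.
  by rewrite ord1 /ball /= mxE sub0r normrN; apply: (le_lt_trans xj); rewrite ltr1n.
Qed.

Lemma cap_zero_point (S : set 'rV[R]_3) : S `<=` [set 0] -> cap_zero S.
Proof.
by move=> S0 F _ FS; apply: compact_cap_zero_point; exact: subset_trans S0.
Qed.

End Capacity_point.

Lemma same_interval_dist (R : realType) (s t c : R) :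
  `|s - c| <= 1 -> `|t - c| <= 1 -> `|s - t| <= 2.
Proof.
rewrite !ler_norml => /andP[s1 s2] /andP[t1 t2].
by apply/andP; split; lra.
Qed.

Lemma next_interval_dist (R : realType) (s t c e : R) : e = 0 \/ e = 1 ->
  `|s - 2 * c| <= 1 -> `|t - 2 * (c + e)| <= 1 -> `|s - t| <= 4.
Proof.
rewrite !ler_norml => e01 /andP[s1 s2] /andP[t1 t2].
by apply/andP; split; case: e01 => e01; lra.
Qed.

(** * The Zorich map on one cell *)

Section Zorich.
Variables (R : realType) (L lambda : R).
Variables (h : 'rV[R]_2 -> 'rV[R]_3) (Z : 'rV[R]_3 -> 'rV[R]_3).
Hypothesis h_bilipschitz : bilipschitz_on L square h.
Hypothesis h_onto : h @` square = upper_hemisphere.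
Hypothesis Z_zorich : zorich_map h Z.
Hypothesis lambda_gt0 : 0 < lambda.
Hypothesis lambda_lt : lambda < expR (- (ln L + L)).

Implicit Types (x y z : 'rV[R]_3) (n m : int).

Lemma row2E (a b : R) : (row2 a b ord0 0 = a) * (row2 a b ord0 1 = b).
Proof. by rewrite /row2 !mxE. Qed.

(** Two points at positive distance give [L^-1 <= L] and [0 <= L]; the value 0 is
    excluded because the map is not constant. *)
Lemma L_ge1 : 1 <= L.
Proof.
pose u : 'rV[R]_2 := row2 1 0; pose v : 'rV[R]_2 := row2 0 0.
have su : square u by move=> [[|[|]]]//= i; rewrite mxE /= ?normr1 ?normr0.
have sv : square v by move=> [[|[|]]]//= i; rewrite mxE /= ?normr1 ?normr0.
have uv : enorm (u - v) = 1.
  apply/eqP; rewrite -(@eqrXn2 _ 2)// ?enorm_ge0// sqr_enorm2 !mxE /=.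
  by rewrite !subr0 expr0n /= addr0.
have /andP[h1 h2] := h_bilipschitz su sv; rewrite uv !mulr1 in h1 h2.
have L0 : 0 <= L := le_trans (enorm_ge0 _) h2.
have [L00|Ln0] := eqVneq L 0; last first.
  have Lp : 0 < L by rewrite lt_def Ln0.
  rewrite leNgt; apply/negP => L1.
  have : L < L^-1 by rewrite (lt_trans L1)// invf_gt1.
  by rewrite ltNge (le_trans h1 h2).
have [w1 [sw1 hw1]] : exists w, square w /\ h w = row3 1 0 0.
  have : (h @` square) (row3 1 0 0).
    rewrite h_onto; split; last by rewrite row3E.
    apply/eqP; rewrite -(@eqrXn2 _ 2)// ?enorm_ge0// sqr_enorm3 !row3E.
    by rewrite expr0n /= !addr0.
  by move=> [w sw <-]; exists w.
have [w2 [sw2 hw2]] : exists w, square w /\ h w = row3 0 1 0.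
  have : (h @` square) (row3 0 1 0).
    rewrite h_onto; split; last by rewrite row3E.
    apply/eqP; rewrite -(@eqrXn2 _ 2)// ?enorm_ge0// sqr_enorm3 !row3E.
    by rewrite expr0n /= add0r addr0.
  by move=> [w sw <-]; exists w.
have /andP[_ h3] := h_bilipschitz sw1 sw2.
have h0 : h w1 - h w2 = 0.
  by apply: enorm_eq0; apply/eqP; rewrite eq_le enorm_ge0 andbT (le_trans h3)// L00 mul0r.
have := congr1 (fun A : 'rV[R]_3 => A ord0 0) h0.
by rewrite hw1 hw2 !mxE /= subr0 => /eqP; rewrite oner_eq0.
Qed.

Lemma L_gt0 : 0 < L. Proof. exact: lt_le_trans ltr01 L_ge1. Qed.

(** The image of the plane at this height is the sphere of radius [L]. Above it
    the map is expanding; below it the map falls into the ball of radius [L],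
    which lies below. *)
Definition height0 : R := ln L - ln lambda.

Lemma exp_height0 : lambda * expR height0 = L.
Proof.
rewrite /height0 expRB !lnK ?posrE ?L_gt0//.
by rewrite mulrCA divff ?mulr1// gt_eqF.
Qed.

Lemma L_lt_height0 : L < height0.
Proof.
have : ln lambda < - (ln L + L).
  by rewrite -[ltRHS]expRK ltr_ln ?posrE ?expR_gt0.
have : 0 <= ln L by rewrite ln_ge0// L_ge1.
rewrite /height0; lra.
Qed.

Definition kappa : R := height0 / L.

Lemma kappa_gt1 : 1 < kappa.
Proof. by rewrite /kappa ltr_pdivlMr ?L_gt0// mul1r L_lt_height0. Qed.

Lemma height0_gt1 : 1 < height0.
Proof. exact: le_lt_trans L_ge1 L_lt_height0. Qed.

Definition in_cell (n m : int) (x : 'rV[R]_3) : Prop :=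
  `|x ord0 0 - 2 * n%:~R| <= 1 /\ `|x ord0 1 - 2 * m%:~R| <= 1.

Definition fold (n m : int) (x : 'rV[R]_3) : 'rV[R]_2 :=
  row2 ((-1) ^ n * (x ord0 0 - 2 * n%:~R)) ((-1) ^ m * (x ord0 1 - 2 * m%:~R)).

Definition direction (n m : int) (x : 'rV[R]_3) : 'rV[R]_3 :=
  let u := fold n m x in
  row3 (h u ord0 0) (h u ord0 1) ((-1) ^ (n + m) * h u ord0 2).

Definition zf (x : 'rV[R]_3) : 'rV[R]_3 := lambda *: Z x.

Lemma signz n : (-1) ^ n = 1 :> R \/ (-1) ^ n = -1 :> R.
Proof.
have nat_case (k : nat) : (-1) ^+ k = 1 :> R \/ (-1) ^+ k = -1 :> R.
  by rewrite -signr_odd; case: (odd k); [right|left]; rewrite ?expr1 ?expr0.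
case: n => k; first exact: nat_case.
rewrite (_ : (-1) ^ Negz k = ((-1) ^+ k.+1)^-1)//.
by case: (nat_case k.+1) => ->; [left|right]; rewrite ?invr1 ?invrN1.
Qed.

Lemma signz_norm n : `|(-1) ^ n : R| = 1.
Proof. by case: (signz n) => ->; rewrite ?normrN normr1. Qed.

Lemma signz_mul n : (-1) ^ n * (-1) ^ n = 1 :> R.
Proof. by case: (signz n) => ->; ring. Qed.

Lemma signzD n m : (-1) ^ (n + m) = (-1) ^ n * (-1) ^ m :> R.
Proof. by rewrite expfzDr// oppr_eq0 oner_eq0. Qed.

Lemma zfE n m x : in_cell n m x ->
  zf x = (lambda * expR (x ord0 2)) *: direction n m x.
Proof. by move=> [xn xm]; rewrite /zf (Z_zorich xn xm) scalerA. Qed.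

Lemma square_fold n m x : in_cell n m x -> square (fold n m x).
Proof.
move=> [xn xm] [[|[|]]]//= i.
  by rewrite (_ : Ordinal i = 0) ?row2E ?normrM ?signz_norm ?mul1r//; exact/val_inj.
by rewrite (_ : Ordinal i = 1) ?row2E ?normrM ?signz_norm ?mul1r//; exact/val_inj.
Qed.

Lemma h_hemisphere u : square u -> enorm (h u) = 1 /\ 0 <= h u ord0 2.
Proof. by move=> su; have : upper_hemisphere (h u) by rewrite -h_onto; exists u. Qed.

Lemma enorm_direction n m x : in_cell n m x -> enorm (direction n m x) = 1.
Proof.
move=> /square_fold/h_hemisphere[h1 _].
apply/eqP; rewrite -(@eqrXn2 _ 2)// ?enorm_ge0// expr1n -(expr1n _ 2) -h1.
rewrite !sqr_enorm3 !row3E exprMn [((-1) ^ _) ^+ 2]expr2 signz_mul mul1r.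
exact/eqP.
Qed.

Lemma cell_exists (t : R) : exists n : int, `|t - 2 * n%:~R| <= 1.
Proof.
exists (Num.floor ((t + 1) / 2)).
have /andP[h1 h2] := floor_itv ((t + 1) / 2).
rewrite intrD in h2; rewrite ler_norml; apply/andP; split; lra.
Qed.

Lemma in_cell_exists x : exists n m, in_cell n m x.
Proof.
have [n xn] := cell_exists (x ord0 0); have [m xm] := cell_exists (x ord0 1).
by exists n, m.
Qed.

Lemma exp_radius_gt0 (t : R) : 0 < lambda * expR t.
Proof. by rewrite mulr_gt0// expR_gt0. Qed.

Lemma enorm_zf x : enorm (zf x) = lambda * expR (x ord0 2).
Proof.
have [n [m nmx]] := in_cell_exists x.
rewrite (zfE nmx) enormZ (enorm_direction nmx) mulr1 gtr0_norm//.
exact: exp_radius_gt0.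
Qed.

Lemma zf_sign n m x : in_cell n m x -> 0 <= (-1) ^ (n + m) * zf x ord0 2.
Proof.
move=> nmx; have [_ h3] := h_hemisphere (square_fold nmx).
rewrite (zfE nmx) mxE row3E.
have -> : (-1) ^ (n + m) * (lambda * expR (x ord0 2) *
    ((-1) ^ (n + m) * h (fold n m x) ord0 2)) =
  ((-1) ^ (n + m) * (-1) ^ (n + m)) * (lambda * expR (x ord0 2) *
    h (fold n m x) ord0 2) by ring.
by rewrite signz_mul mul1r mulr_ge0// ltW// exp_radius_gt0.
Qed.

(** The modulus of the image determines the height, and its direction the
    horizontal coordinates, as [h] is onto. *)
Lemma zf_onto n m y : y != 0 -> 0 <= (-1) ^ (n + m) * y ord0 2 ->
  exists2 x, in_cell n m x & zf x = y.
Proof.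
move=> y0 ys.
have ny0 : 0 < enorm y.
  by rewrite lt_def enorm_ge0 andbT; apply: contraNneq y0 => /enorm_eq0 ->.
pose s : R := (-1) ^ (n + m); pose r := enorm y.
pose w : 'rV[R]_3 := row3 (y ord0 0 / r) (y ord0 1 / r) (s * y ord0 2 / r).
have [u su hu] : (h @` square) w.
  rewrite h_onto; split; last by rewrite row3E divr_ge0// ltW.
  apply/eqP; rewrite -(@eqrXn2 _ 2)// ?enorm_ge0// expr1n sqr_enorm3 !row3E.
  have -> : (s * y ord0 2 / r) ^+ 2 = (y ord0 2 / r) ^+ 2.
    by rewrite -mulrA exprMn [s ^+ 2]expr2 signz_mul mul1r.
  rewrite !expr_div_n -!mulrDl -sqr_enorm3 divff//.
  by rewrite expf_neq0// gt_eqF.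
have uE (i : 'I_2) : `|u ord0 i| <= 1 by exact: su.
pose x : 'rV[R]_3 := row3 (2 * n%:~R + (-1) ^ n * u ord0 0)
  (2 * m%:~R + (-1) ^ m * u ord0 1) (ln (r / lambda)).
have cx : in_cell n m x.
  by split; rewrite row3E addrAC subrr add0r normrM signz_norm mul1r uE.
exists x => //; rewrite (zfE cx).
have fx : fold n m x = u.
  apply/rowP => -[[|[|]]]//= i.
    rewrite (_ : Ordinal i = 0) ?row2E ?row3E; last exact/val_inj.
    by rewrite addrAC subrr add0r mulrA signz_mul mul1r.
  rewrite (_ : Ordinal i = 1) ?row2E ?row3E; last exact/val_inj.
  by rewrite addrAC subrr add0r mulrA signz_mul mul1r.
have -> : lambda * expR (x ord0 2) = r.
  rewrite row3E lnK ?posrE ?divr_gt0// mulrCA divff ?mulr1// gt_eqF//.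
have r0 : r != 0 by rewrite gt_eqF.
rewrite /direction fx hu; apply/rowP; apply: ord3P; rewrite mxE !row3E.
- by field.
- by field.
- rewrite !mulrA [r * _]mulrC -/s (_ : s * r * s = r); last first.
    by rewrite mulrAC signz_mul mul1r.
  by field.
Qed.

Lemma sqr_dist_rays (p q : 'rV[R]_3) (a b : R) : enorm p = 1 -> enorm q = 1 ->
  enorm (a *: p - b *: q) ^+ 2 = (a - b) ^+ 2 + a * b * enorm (p - q) ^+ 2.
Proof.
move=> p1 q1; have := sqr_enorm3 q; have := sqr_enorm3 p; rewrite p1 q1 expr1n.
have cE (c d : R) i : (c *: p - d *: q) ord0 i = c * p ord0 i - d * q ord0 i.
  by rewrite !mxE.
have dE i : (p - q) ord0 i = p ord0 i - q ord0 i by rewrite !mxE.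
rewrite !sqr_enorm3 !cE !dE.
move: (p ord0 0) (p ord0 1) (p ord0 2) (q ord0 0) (q ord0 1) (q ord0 2).
move=> p0 p1' p2 q0 q1' q2 hp hq.
have -> : (a * p0 - b * q0) ^+ 2 + (a * p1' - b * q1') ^+ 2 + (a * p2 - b * q2) ^+ 2
  = a ^+ 2 * (p0 ^+ 2 + p1' ^+ 2 + p2 ^+ 2) + b ^+ 2 * (q0 ^+ 2 + q1' ^+ 2 + q2 ^+ 2)
    - 2 * a * b * (p0 * q0 + p1' * q1' + p2 * q2) by ring.
have -> : (p0 - q0) ^+ 2 + (p1' - q1') ^+ 2 + (p2 - q2) ^+ 2
  = (p0 ^+ 2 + p1' ^+ 2 + p2 ^+ 2) + (q0 ^+ 2 + q1' ^+ 2 + q2 ^+ 2)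
    - 2 * (p0 * q0 + p1' * q1' + p2 * q2) by ring.
by rewrite -hp -hq; ring.
Qed.

Lemma sqr_dist_fold n m x y : enorm (fold n m x - fold n m y) ^+ 2 =
  (x ord0 0 - y ord0 0) ^+ 2 + (x ord0 1 - y ord0 1) ^+ 2.
Proof.
have dE i : (fold n m x - fold n m y) ord0 i = fold n m x ord0 i - fold n m y ord0 i.
  by rewrite !mxE.
rewrite sqr_enorm2 !dE !row2E -!mulrBr !exprMn ![((-1) ^ _) ^+ 2]expr2 !signz_mul.
by rewrite !mul1r; congr (_ ^+ _ + _ ^+ _); ring.
Qed.

Lemma sqr_dist_zf n m x y : in_cell n m x -> in_cell n m y ->
  let a := lambda * expR (x ord0 2) in let b := lambda * expR (y ord0 2) in
  enorm (zf x - zf y) ^+ 2 =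
    (a - b) ^+ 2 + a * b * enorm (h (fold n m x) - h (fold n m y)) ^+ 2.
Proof.
move=> cx cy a b; rewrite (zfE cx) (zfE cy) sqr_dist_rays ?enorm_direction//.
congr (_ + _ * _).
have dE (p q : 'rV[R]_3) i : (p - q) ord0 i = p ord0 i - q ord0 i by rewrite !mxE.
rewrite !sqr_enorm3 !dE /direction !row3E -mulrBr exprMn [((-1) ^ _) ^+ 2]expr2.
by rewrite signz_mul mul1r.
Qed.

(** On rays through unit vectors, the squared distance is the sum of a radial and
    a tangential part. The first is at least [A] times the vertical distance by
    convexity of [expR], the second [A / L] times the horizontal one since [h] is
    bi-Lipschitz. *)
Lemma zf_expanding n m x y (A : R) : in_cell n m x -> in_cell n m y ->
  0 < A -> A <= enorm (zf x) -> A <= enorm (zf y) ->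
  A / L * enorm (x - y) <= enorm (zf x - zf y).
Proof.
move=> cx cy A0; rewrite !enorm_zf => Ax Ay.
have L0 := L_gt0; have L1 := L_ge1.
have AL0 : 0 <= A / L by apply: divr_ge0; exact: ltW.
have AL1 : 0 <= A / L * enorm (x - y) by apply: mulr_ge0 => //; exact: enorm_ge0.
rewrite -(@ler_pXn2r _ 2)// ?nnegrE ?enorm_ge0//.
rewrite exprMn (sqr_dist_zf cx cy) [enorm (x - y) ^+ 2]sqr_enorm3.
have dE i : (x - y) ord0 i = x ord0 i - y ord0 i by rewrite !mxE.
rewrite !dE -(sqr_dist_fold n m).
have /andP[hlow _] := h_bilipschitz (square_fold cx) (square_fold cy).
set d := enorm (fold n m x - _) in hlow *; set e := enorm (h _ - _) in hlow *.
have d0 : 0 <= d := enorm_ge0 _.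
set a := lambda * expR (x ord0 2) in Ax *; set b := lambda * expR (y ord0 2) in Ay *.
set t := x ord0 2 - y ord0 2.
have rad : (A * t) ^+ 2 <= (a - b) ^+ 2.
  have bt : b * t <= a - b.
    have -> : a - b = b * (expR t - 1).
      by rewrite /a /b /t expRB; have := expR_gt0 (y ord0 2) => y0; field; rewrite gt_eqF.
    by rewrite ler_wpM2l ?lerBrDl ?expR_ge1Dx// ltW// exp_radius_gt0.
  have at_ : a * - t <= b - a.
    have -> : b - a = a * (expR (- t) - 1).
      by rewrite /a /b /t opprB expRB; have := expR_gt0 (x ord0 2) => y0; field; rewrite gt_eqF.
    by rewrite ler_wpM2l ?lerBrDl ?expR_ge1Dx// ltW// exp_radius_gt0.
  have [t0|t0] := leP 0 t.
    rewrite lerXn2r// ?nnegrE ?mulr_ge0 ?(ltW A0)//.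
      by apply: le_trans bt; rewrite mulr_ge0// (le_trans (ltW A0)).
    by apply: le_trans bt; rewrite ler_wpM2r.
  rewrite -[(A * t) ^+ 2]sqrrN -[(a - b) ^+ 2]sqrrN opprB -mulrN.
  have t0' : 0 <= - t by rewrite oppr_ge0 ltW.
  rewrite lerXn2r// ?nnegrE ?mulr_ge0 ?(ltW A0)//.
    by apply: le_trans at_; rewrite mulr_ge0// (le_trans (ltW A0)).
  by apply: le_trans at_; rewrite ler_wpM2r.
have tan : (A * (L^-1 * d)) ^+ 2 <= a * b * e ^+ 2.
  rewrite exprMn; apply: ler_pM; rewrite ?sqr_ge0//.
    by rewrite expr2 ler_pM// ltW.
  by rewrite lerXn2r// nnegrE ?enorm_ge0// mulr_ge0// invr_ge0 ltW.
have L2 : 1 <= L ^+ 2 by rewrite exprn_ege1.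
have -> : (A / L) ^+ 2 * (d ^+ 2 + t ^+ 2) =
    (A * (L^-1 * d)) ^+ 2 + (A * t) ^+ 2 / L ^+ 2.
  have L00 : L != 0 by rewrite gt_eqF.
  by field.
rewrite [leLHS]addrC lerD//; apply: le_trans rad; rewrite ler_pdivrMr ?exprn_gt0//.
by rewrite ler_peMr// sqr_ge0.
Qed.

(** On a face one of the two adjacent cells contains the nearby point as well. *)
Lemma cell_near (t : R) : exists2 e : R, 0 < e & forall s, `|t - s| < e ->
  exists n : int, `|t - 2 * n%:~R| <= 1 /\ `|s - 2 * n%:~R| <= 1.
Proof.
have [n tn] := cell_exists t.
have [tn1|tn1] := ltP `|t - 2 * n%:~R| 1.
  exists (1 - `|t - 2 * n%:~R|); first by rewrite subr_gt0.
  move=> s ts; exists n; split=> //.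
  have -> : s - 2 * n%:~R = (t - 2 * n%:~R) - (t - s) by ring.
  by apply: (le_trans (ler_normB _ _)); lra.
have : (t - 2 * n%:~R) = 1 \/ (t - 2 * n%:~R) = -1.
  have : `|t - 2 * n%:~R| = 1 by apply/eqP; rewrite eq_le tn.
  have [t0|t0] := leP 0 (t - 2 * n%:~R).
    by rewrite ger0_norm//; left.
  by rewrite ltr0_norm// => /eqP; rewrite eqr_oppLR => /eqP ->; right.
exists 1 => // s; rewrite ltr_norml => /andP[s1 s2].
case: H => tE.
  have [st|st] := leP s t; first by exists n; split=> //; rewrite ler_norml; lra.
  exists (n + 1); rewrite intrD !ler_norml; split; apply/andP; split; lra.
have [st|st] := leP t s; first by exists n; split=> //; rewrite ler_norml; lra.
exists (n - 1); rewrite intrB !ler_norml; split; apply/andP; split; lra.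
Qed.

(** Nearby points share a cell, where the formula of [sqr_dist_zf] applies. *)
Lemma zf_continuous : continuous zf.
Proof.
move=> x; apply/(@cvgrPdist_lt _ _ _ (nbhs x) (nbhs_filter x)) => e e0.
have [d0 d00 c0] := cell_near (x ord0 0); have [d1 d10 c1] := cell_near (x ord0 1).
pose a := lambda * expR (x ord0 2).
pose G (y : 'rV[R]_3) := (a - lambda * expR (y ord0 2)) ^+ 2 +
  a * (lambda * expR (y ord0 2)) * (L ^+ 2 *
    ((x ord0 0 - y ord0 0) ^+ 2 + (x ord0 1 - y ord0 1) ^+ 2)).
have cco i : continuous (fun y : 'rV[R]_3 => y ord0 i) by exact: coord_continuous.
have cE : continuous (fun y : 'rV[R]_3 => lambda * expR (y ord0 2)).
  apply: continuous_mul; first exact: cst_continuous.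
  by move=> y; apply: continuous_comp; [exact: cco|exact: continuous_expR].
have cG : continuous G.
  apply: continuous_add; first exact: continuous_sqr_dist.
  apply: continuous_mul.
    by apply: continuous_mul; [exact: cst_continuous|exact: cE].
  apply: continuous_mul; first exact: cst_continuous.
  by apply: continuous_add; apply: continuous_sqr_dist; exact: cco.
have Gx : G x = 0.
  by rewrite /G !subrr expr0n /= addr0 !mulr0 addr0.
near=> y.
have [n [xn yn]] : exists n : int,
    `|x ord0 0 - 2 * n%:~R| <= 1 /\ `|y ord0 0 - 2 * n%:~R| <= 1.
  by apply: c0; near: y; exact: near_coord_dist.
have [m [xm ym]] : exists n : int,
    `|x ord0 1 - 2 * n%:~R| <= 1 /\ `|y ord0 1 - 2 * n%:~R| <= 1.
  by apply: c1; near: y; exact: near_coord_dist.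
have Gy : G y < e ^+ 2.
  near: y; apply: (near_lt cG); rewrite Gx; exact: exprn_gt0.
have cx : in_cell n m x by []; have cy : in_cell n m y by [].
have ne : enorm (zf x - zf y) < e.
  rewrite -(@ltr_pXn2r _ 2)// ?nnegrE ?enorm_ge0 ?ltW//.
  apply: le_lt_trans Gy; rewrite (sqr_dist_zf cx cy) /G lerD2l ler_wpM2l//.
    by rewrite mulr_ge0// ltW// exp_radius_gt0.
  rewrite -(sqr_dist_fold n m) -exprMn lerXn2r// ?nnegrE ?enorm_ge0//.
    by rewrite mulr_ge0 ?enorm_ge0// ltW// L_gt0.
  by have /andP[] := h_bilipschitz (square_fold cx) (square_fold cy).
rewrite [`|_|]mx_normrE; apply/bigmax_ltP; split=> // -[i j] _ /=.
by rewrite ord1; apply: le_lt_trans ne; exact: coord_le_enorm.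
Unshelve. all: by end_near.
Qed.

(** * Cells and itineraries *)

(** Points of a face belong to two cells of opposite parity, so that their image
    lies in both half-spaces, at height 0; a positive height of the image thus
    excludes the faces and the odd cells. *)
Lemma zf_pos_cell n m x : in_cell n m x -> 0 < zf x ord0 2 ->
  [/\ `|x ord0 0 - 2 * n%:~R| < 1, `|x ord0 1 - 2 * m%:~R| < 1
    & (-1) ^ (n + m) = 1 :> R].
Proof.
move=> cx f0; have [xn xm] := cx; have s0 := zf_sign cx.
have sE : (-1) ^ (n + m) = 1 :> R.
  case: (signz (n + m)) => // sE; move: s0; rewrite sE mulN1r oppr_ge0.
  by rewrite leNgt f0.
have odd_cell n' m' : in_cell n' m' x -> (-1) ^ (n' + m') = 1 :> R.
  move=> cx'; have := zf_sign cx'; case: (signz (n' + m')) => // ->.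
  by rewrite mulN1r oppr_ge0 leNgt f0.
have step (k : int) : (-1) ^ (k + 1) = - (-1) ^ k :> R.
  by rewrite signzD expr1z mulrN1.
have step' (k : int) : (-1) ^ (k - 1) = - (-1) ^ k :> R.
  by rewrite signzD (_ : (-1) ^ (-1)%R = -1 :> R) ?mulrN1// exprN1 invrN1.
have absurd : (1 : R) = -1 -> False by move=> *; lra.
have nofaces (t : R) (k : int) : `|t - 2 * k%:~R| <= 1 -> ~ `|t - 2 * k%:~R| < 1 ->
    `|t - 2 * (k + 1)%:~R| <= 1 \/ `|t - 2 * (k - 1)%:~R| <= 1.
  rewrite intrD intrB => t1 /negP; rewrite -leNgt => t2.
  have [t0|t0] := leP 0 (t - 2 * k%:~R).
    by left; move: t1 t2; rewrite (ger0_norm t0) ler_norml => *; lra.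
  by right; move: t1 t2; rewrite (ltr0_norm t0) ler_norml => *; lra.
split=> //.
- apply: contrapT => /(nofaces _ _ xn)[] c.
    have := odd_cell (n + 1) m (conj c xm).
    by rewrite addrAC step sE => /esym; exact: absurd.
  have := odd_cell (n - 1) m (conj c xm).
  by rewrite addrAC step' sE => /esym; exact: absurd.
- apply: contrapT => /(nofaces _ _ xm)[] c.
    have := odd_cell n (m + 1) (conj xn c).
    by rewrite addrA step sE => /esym; exact: absurd.
  have := odd_cell n (m - 1) (conj xn c).
  by rewrite addrA step' sE => /esym; exact: absurd.
Qed.

Definition cell (x : 'rV[R]_3) : int * int :=
  (Num.floor ((x ord0 0 + 1) / 2), Num.floor ((x ord0 1 + 1) / 2)).

Lemma in_cell_cell x : in_cell (cell x).1 (cell x).2 x.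
Proof.
split; rewrite /cell /=.
  have /andP[h1 h2] := floor_itv ((x ord0 0 + 1) / 2).
  rewrite intrD in h2; rewrite ler_norml; apply/andP; split; lra.
have /andP[h1 h2] := floor_itv ((x ord0 1 + 1) / 2).
rewrite intrD in h2; rewrite ler_norml; apply/andP; split; lra.
Qed.

Lemma cell_interior n m x : `|x ord0 0 - 2 * n%:~R| < 1 ->
  `|x ord0 1 - 2 * m%:~R| < 1 -> cell x = (n, m).
Proof.
rewrite !ltr_norml => /andP[a b] /andP[c d].
by congr pair; apply: floor_def; rewrite intrD; apply/andP; split; lra.
Qed.

(** This turns out to be the Julia set: the orbit stays where the map expands. *)
Definition J (x : 'rV[R]_3) : Prop := forall k, height0 < iter k zf x ord0 2.

Lemma J_height x : J x -> height0 < x ord0 2.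
Proof. by move/(_ 0%N). Qed.

Lemma J_zf x : J x -> J (zf x).
Proof. by move=> Jx k; rewrite -iterSr; exact: Jx. Qed.

Lemma J_iter k x : J x -> J (iter k zf x).
Proof. by move=> Jx; elim: k => //= k; exact: J_zf. Qed.

Lemma height0_gt0 : 0 < height0. Proof. exact: lt_trans ltr01 height0_gt1. Qed.

Lemma J_zf_gt0 x : J x -> 0 < zf x ord0 2.
Proof. by move/(_ 1%N) => /=; exact: lt_trans height0_gt0. Qed.

Lemma J_enorm x : J x -> height0 < enorm x.
Proof.
move=> /J_height Jx; apply: (lt_le_trans Jx); apply: le_trans (ler_norm _) _.
exact: coord_le_enorm.
Qed.

Lemma J_cell n m x : J x -> in_cell n m x -> cell x = (n, m).
Proof.
move=> Jx cx; have [h1 h2 _] := zf_pos_cell cx (J_zf_gt0 Jx).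
exact: cell_interior.
Qed.

Lemma J_cell_sign x : J x -> (-1) ^ ((cell x).1 + (cell x).2) = 1 :> R.
Proof. by move=> Jx; have [_ _] := zf_pos_cell (in_cell_cell x) (J_zf_gt0 Jx). Qed.

Lemma near_cell x : J x -> \forall y \near x, cell y = cell x.
Proof.
move=> Jx; have [h1 h2 _] := zf_pos_cell (in_cell_cell x) (J_zf_gt0 Jx).
have d1 : 0 < 1 - `|x ord0 0 - 2 * (cell x).1%:~R| by rewrite subr_gt0.
have d2 : 0 < 1 - `|x ord0 1 - 2 * (cell x).2%:~R| by rewrite subr_gt0.
near=> y; apply: (@cell_interior (cell x).1 (cell x).2).
  have : `|x ord0 0 - y ord0 0| < 1 - `|x ord0 0 - 2 * (cell x).1%:~R|.
    by near: y; exact: near_coord_dist.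
  have -> : y ord0 0 - 2 * (cell x).1%:~R =
    (x ord0 0 - 2 * (cell x).1%:~R) - (x ord0 0 - y ord0 0) by ring.
  by move=> ?; apply: (le_lt_trans (ler_normB _ _)); lra.
have : `|x ord0 1 - y ord0 1| < 1 - `|x ord0 1 - 2 * (cell x).2%:~R|.
  by near: y; exact: near_coord_dist.
have -> : y ord0 1 - 2 * (cell x).2%:~R =
  (x ord0 1 - 2 * (cell x).2%:~R) - (x ord0 1 - y ord0 1) by ring.
by move=> ?; apply: (le_lt_trans (ler_normB _ _)); lra.
Unshelve. all: by end_near.
Qed.

Lemma J_expanding x y : J x -> J y -> cell x = cell y ->
  kappa * enorm (x - y) <= enorm (zf x - zf y).
Proof.
move=> Jx Jy xy; have cx := in_cell_cell x; have cy := in_cell_cell y.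
rewrite -xy in cy; apply: (zf_expanding cx cy height0_gt0);
  by apply: ltW; apply: J_enorm; exact: J_zf.
Qed.

Lemma kappa_gt0 : 0 < kappa. Proof. exact: lt_trans ltr01 kappa_gt1. Qed.

Lemma iter_expanding N x y : J x -> J y ->
  (forall k, (k < N)%N -> cell (iter k zf x) = cell (iter k zf y)) ->
  kappa ^+ N * enorm (x - y) <= enorm (iter N zf x - iter N zf y).
Proof.
move=> Jx Jy; elim: N => [|N ih] cxy; first by rewrite expr0 mul1r.
rewrite exprS -mulrA /=; apply: le_trans (J_expanding _ _ (cxy N _)) => //.
- rewrite ler_wpM2l ?(ltW kappa_gt0)//; apply: ih => k kN; apply: cxy.
  exact: ltnW.
- exact: J_iter.
- exact: J_iter.
Qed.

(** A point above [height0] has modulus greater than [L], hence its preimages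
    are above [height0]: inverse branches preserve [J]. *)
Lemma pull_height n m x y : in_cell n m x -> zf x = y -> height0 < y ord0 2 ->
  height0 < x ord0 2.
Proof.
move=> cx fx yh; have : lambda * expR height0 < lambda * expR (x ord0 2).
  rewrite exp_height0 -enorm_zf fx; apply: (lt_trans L_lt_height0).
  apply: (lt_le_trans yh); apply: le_trans (ler_norm _) _; exact: coord_le_enorm.
by rewrite ltr_pM2l// ltr_expR.
Qed.

Lemma pull x y : J x -> J y -> exists x', [/\ J x', zf x' = y & cell x' = cell x].
Proof.
move=> Jx Jy; have yh := J_height Jy.
have y0 : y != 0.
  apply/eqP => y0; move: yh; rewrite y0 mxE; apply/negP.
  by rewrite -leNgt ltW// height0_gt0.
have [x' cx' fx'] : exists2 x', in_cell (cell x).1 (cell x).2 x' & zf x' = y.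
  apply: zf_onto => //; rewrite J_cell_sign// mul1r ltW//.
  exact: lt_trans height0_gt0 yh.
have Jx' : J x'.
  case=> [|k] /=; first exact: pull_height cx' fx' yh.
  by rewrite -iterS iterSr fx'; exact: Jy.
by exists x'; split=> //; rewrite (J_cell Jx' cx') -surjective_pairing.
Qed.

Lemma pullback N x y : J x -> J y -> exists x', [/\ J x', iter N zf x' = y
  & forall k, (k < N)%N -> cell (iter k zf x') = cell (iter k zf x)].
Proof.
elim: N x => [|N ih] x Jx Jy; first by exists y.
have [x1 [Jx1 x1y cx1]] := ih (zf x) (J_zf Jx) Jy.
have [x' [Jx' fx' cx']] := pull Jx Jx1.
exists x'; split=> //; first by rewrite iterSr fx'.
by case=> [_|k kN]; rewrite ?cx'// !iterSr fx'; exact: cx1.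
Qed.

Lemma iter_zf_continuous k : continuous (iter k zf).
Proof.
elim: k => [|k ih] x; first exact: cvg_id.
have := @continuous_comp _ _ _ (iter k zf) zf x (ih x); apply.
exact: zf_continuous.
Qed.

(** A limit of points above [height0] could be at [height0], but then its image
    would be in the ball of radius [L] and thus below. *)
Lemma closed_J : closed [set x | J x].
Proof.
have -> : [set x | J x] =
    \bigcap_k [set x | height0 <= iter k zf x ord0 2].
  apply/seteqP; split=> x Jx => [k _|k]; first exact: ltW (Jx k).
  have h1 := Jx k.+1 I; rewrite /= in h1.
  have : lambda * expR height0 < lambda * expR (iter k zf x ord0 2).
    rewrite exp_height0 -enorm_zf; apply: (lt_le_trans L_lt_height0).
    apply: (le_trans h1); apply: le_trans (ler_norm _) _; exact: coord_le_enorm.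
  by rewrite ltr_pM2l// ltr_expR.
apply: closed_bigI => k _.
have ck : continuous (fun x : 'rV[R]_3 => iter k zf x ord0 2 : R).
  have cc : continuous (fun y : 'rV[R]_3 => y ord0 2) by exact: coord_continuous.
  exact: (continuous_compose (@iter_zf_continuous k) cc).
exact: closed_ge_fun.
Qed.

(** * The Julia set *)

(** Above [height0] the inverse branch into a given cell of the orbit is defined
    and contracts by [kappa], so that the covered part of a ball grows by this
    factor at each step; no face or edge of a beam has to be crossed. *)
Lemma iter_cover k x y (r : R) : J x -> height0 < y ord0 2 ->
  enorm (iter k zf x - y) < kappa ^+ k * r ->
  exists x', [/\ enorm (x - x') < r, iter k zf x' = y & height0 < x' ord0 2].
Proof.
elim: k x r => [|k ih] x r Jx yh; first by rewrite expr0 mul1r => xy; exists y.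
rewrite iterSr exprSr -mulrA => xy.
have [x1 [xx1 x1y h1]] := ih _ _ (J_zf Jx) yh xy.
have x10 : x1 != 0.
  apply/eqP => x10; move: h1; rewrite x10 mxE; apply/negP.
  by rewrite -leNgt ltW// height0_gt0.
have [x' cx' fx'] : exists2 x', in_cell (cell x).1 (cell x).2 x' & zf x' = x1.
  apply: zf_onto => //; rewrite J_cell_sign// mul1r ltW//.
  exact: lt_trans height0_gt0 h1.
exists x'; split; last exact: pull_height cx' fx' h1.
  rewrite -(ltr_pM2l kappa_gt0); apply: le_lt_trans xx1.
  rewrite -fx'; apply: (zf_expanding (in_cell_cell x) cx' height0_gt0).
    by apply: ltW; apply: J_enorm; exact: J_zf.
  rewrite fx' ltW//; apply: (lt_le_trans h1); apply: le_trans (ler_norm _) _.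
  exact: coord_le_enorm.
by rewrite iterSr fx'.
Qed.

Lemma signz_choice (p : int) (t : R) : exists e : int,
  [/\ (e = 0 \/ e = 1) & 0 <= (-1) ^ (p + e) * t].
Proof.
have [h0|h0] := leP 0 ((-1) ^ p * t); first by exists 0; rewrite addr0; split; [left|].
exists 1; split; first by right.
by rewrite signzD expr1z mulrN1 mulNr oppr_ge0 ltW.
Qed.

(** Bernoulli's inequality. *)
Lemma big_power (b c : R) : 1 < b -> exists k, c < b ^+ k.
Proof.
move=> b1; exists (Num.truncn (c / (b - 1))).+1.
have b0 : 0 < b - 1 by rewrite subr_gt0.
have := truncnS_gt (c / (b - 1)); rewrite ltr_pdivrMr//.
set k := (_.+1); move=> ck; apply: (lt_le_trans ck).
have bern (j : nat) : 1 + j%:R * (b - 1) <= b ^+ j.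
  elim: j => [|j ih]; first by rewrite mul0r addr0.
  rewrite exprS; apply: (@le_trans _ _ (b * (1 + j%:R * (b - 1)))).
    have j0 : 0 <= j%:R * (b - 1) ^+ 2 by rewrite mulr_ge0// sqr_ge0.
    by rewrite -natr1; lra.
  by rewrite ler_pM2l// (lt_trans ltr01).
by apply: le_trans (bern k); rewrite lerDr.
Qed.

(** Every [y] off the origin has preimages [w] in all cells of the right parity,
    at a height depending only on its modulus. Far enough from the axis, [w] has
    in turn a preimage [v] slightly above the orbit, at a distance less than
    [14 + T] where [T] does not depend on the time [k]. *)
Lemma J_near_cover x (r : R) y : J x -> 0 < r -> y != 0 ->
  exists x' k, enorm (x - x') < r /\ iter k.+1 zf x' = y.
Proof.
move=> Jx r0 y0.
have ny0 : 0 < enorm y.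
  by rewrite lt_def enorm_ge0 andbT; apply: contraNneq y0 => /enorm_eq0 ->.
pose T := `|ln (enorm y / lambda)|.
have T0 : 0 <= T by exact: normr_ge0.
have [k hk] : exists k, (14 + T) / r < kappa ^+ k by apply: big_power; exact: kappa_gt1.
pose p := iter k zf x; have Jp : J p by exact: J_iter.
pose a := enorm (zf p).
have a1 : 1 < a by apply: (lt_trans height0_gt1); apply: J_enorm; exact: J_zf.
(* The cell [n0] is so far out that the preimage [v] of [w] below is above the
   orbit, but not much higher. *)
have [n0 [n0a n0b]] : exists n0 : int, a < n0%:~R /\ n0%:~R <= a + 1.
  exists (Posz (Num.truncn a).+1); rewrite -pmulrn; split; first exact: truncnS_gt.
  rewrite -natr1 lerD2r; have a0 : 0 <= a by lra.
  by have /andP[] := truncn_itv a0.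
(* One of two adjacent cells has the parity that fits the sign of the height. *)
have [e [e01 es]] := signz_choice n0 (y ord0 2).
have [w cw fw] : exists2 w, in_cell (n0 + e) 0 w & zf w = y.
  by apply: zf_onto => //; rewrite addr0.
have wT : `|w ord0 2| = T.
  rewrite /T -fw enorm_zf; congr (`|_|).
  by rewrite mulrAC divff ?mul1r ?expRK// gt_eqF.
have [wn wm] := cw; rewrite mulr0 subr0 in wm.
have eR : (e%:~R : R) = 0 \/ (e%:~R : R) = 1.
  by case: e01 => ->; [left|right].
rewrite intrD in wn.
have w0 : 2 * a - 1 <= w ord0 0 /\ w ord0 0 <= 2 * a + 5.
  move: wn; rewrite ler_norml => /andP[wn1 wn2].
  by split; case: eR => eE; rewrite eE in wn1 wn2; lra.
have aw : a < enorm w.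
  apply: lt_le_trans (coord_le_enorm w 0); apply: lt_le_trans (ler_norm _); lra.
have wa : enorm w <= a * (8 + T).
  apply: (le_trans (enorm_le_sum3 w)); rewrite wT.
  rewrite (@ger0_norm _ (w ord0 0)); last by lra.
  have : T <= a * T by rewrite ler_peMl// ltW.
  lra.
have w_neq0 : w != 0.
  by apply: contraTneq aw => ->; rewrite enorm0 -leNgt; lra.
have [e' [e01' es']] := signz_choice ((cell p).1 + (cell p).2) (w ord0 2).
have [v cv fv] : exists2 v, in_cell ((cell p).1 + e') (cell p).2 v & zf v = w.
  by apply: zf_onto => //; rewrite addrAC.
have up : p ord0 2 < v ord0 2.
  by move: aw; rewrite /a -fv !enorm_zf ltr_pM2l// ltr_expR.
have vp2 : v ord0 2 - p ord0 2 <= 8 + T.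
  have : expR (v ord0 2 - p ord0 2) <= 8 + T.
    move: wa; rewrite /a -fv !enorm_zf expRB ler_pdivrMr ?expR_gt0// -mulrA.
    by rewrite ler_pM2l// mulrC.
  move=> vp; apply: le_trans vp; apply: le_trans (expR_ge1Dx _).
  by rewrite lerDr.
have eR' : (e'%:~R : R) = 0 \/ (e'%:~R : R) = 1.
  by case: e01' => ->; [left|right].
have pv : enorm (p - v) < kappa ^+ k * r.
  apply: (@le_lt_trans _ _ (14 + T)); last by rewrite -ltr_pdivrMr.
  apply: (le_trans (enorm_le_sum3 _)).
  have dE i : (p - v) ord0 i = p ord0 i - v ord0 i by rewrite !mxE.
  rewrite !dE; have [pn pm] := in_cell_cell p; have [vn vm] := cv.
  rewrite intrD in vn.
  have d0 : `|p ord0 0 - v ord0 0| <= 4 by exact: next_interval_dist eR' pn vn.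
  have d1 : `|p ord0 1 - v ord0 1| <= 2 by exact: same_interval_dist pm vm.
  have d2 : `|p ord0 2 - v ord0 2| <= 8 + T.
    by rewrite distrC ger0_norm// subr_ge0 ltW.
  apply: (le_trans (lerD (lerD d0 d1) d2)).
  by rewrite (_ : 4 + 2 + (8 + T) = 14 + T)//; ring.
have vh : height0 < v ord0 2 by apply: lt_trans up; exact: J_height.
have [x' [xx' x'v _]] := iter_cover Jx vh pv.
by exists x', k.+1; split=> //; rewrite /= x'v fv fw.
Qed.

Lemma J_sub_julia : [set x | J x] `<=` julia zf.
Proof.
move=> x Jx U /near_box[e e0 eU]; apply: cap_zero_point => y /= Uy.
apply: contrapT => /eqP y0; apply: Uy.
have [x' [k [xx' fy]]] := J_near_cover Jx e0 y0.
exists k.+1 => //; exists x' => //; apply: eU => i.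
apply: le_lt_trans xx'.
by have := coord_le_enorm (x - x') i; rewrite !mxE.
Qed.

Lemma zf_below x : x ord0 2 <= height0 -> enorm (zf x) <= L.
Proof. by move=> xh; rewrite enorm_zf -exp_height0 ler_pM2l// ler_expR. Qed.

Lemma iter_zf_below x k : x ord0 2 <= height0 -> enorm (iter k.+1 zf x) <= L.
Proof.
elim: k x => [|k ih] x xh; first exact: zf_below.
rewrite iterSr; apply: ih; apply: le_trans (ler_norm _) _.
apply: le_trans (coord_le_enorm _ _) _; apply: (le_trans (zf_below xh)).
by rewrite ltW// L_lt_height0.
Qed.

Lemma iter_zf_bound (c : R) k : exists K, forall x, x ord0 2 <= c ->
  forall j, (0 < j <= k)%N -> enorm (iter j zf x) <= K.
Proof.
elim: k => [|k [K Kk]].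
  by exists 0 => x _ j /andP[j0]; rewrite leqNgt j0.
have step : exists K', forall x, x ord0 2 <= c -> enorm (iter k.+1 zf x) <= K'.
  case: k Kk => [|k] Kk.
    exists (lambda * expR c) => x xc.
    by rewrite /= enorm_zf ler_pM2l// ler_expR.
  exists (lambda * expR K) => x xc; rewrite iterS enorm_zf ler_pM2l// ler_expR.
  apply: le_trans (ler_norm _) _; apply: le_trans (coord_le_enorm _ _) _.
  by apply: Kk => //; rewrite ltnS leqnn.
have [K' hK'] := step; exists (Num.max K K') => x xc j /andP[j0].
rewrite leq_eqVlt => /orP[/eqP ->|jk]; first by rewrite le_max hK' ?orbT.
by rewrite le_max (Kk x xc)// j0.
Qed.

(** Off [J] the orbits eventually stay in the ball of radius [L], uniformly near
    the given point, so that the iterates of a neighbourhood miss a box. *)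
Lemma julia_sub_J : julia zf `<=` [set x | J x].
Proof.
move=> x jx k; rewrite ltNge; apply/negP => xk.
have ck : continuous (fun y : 'rV[R]_3 => iter k.+1 zf y ord0 2 : R).
  have cc : continuous (fun y : 'rV[R]_3 => y ord0 2) by exact: coord_continuous.
  exact: (continuous_compose (@iter_zf_continuous k.+1) cc).
have xk1 : iter k.+1 zf x ord0 2 < height0.
  apply: (le_lt_trans (ler_norm _)); apply: (le_lt_trans (coord_le_enorm _ _)).
  by apply: (le_lt_trans (zf_below xk)); exact: L_lt_height0.
pose U := [set y : 'rV[R]_3 | iter k.+1 zf y ord0 2 < height0 /\ y ord0 2 < x ord0 2 + 1].
have Ux : nbhs x U.
  have h1 := near_lt ck xk1.
  have h2 : \forall y \near x, (y : 'rV[R]_3) ord0 2 < x ord0 2 + 1.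
    apply: (@near_lt _ _ (fun y : 'rV[R]_3 => y ord0 2)); first exact: coord_continuous.
    by rewrite ltrDl.
  by near=> y; split; near: y.
have [K hK] := iter_zf_bound (x ord0 2 + 1) k.+1.
pose K' := Num.max K L.
have orbU y j : U y -> (0 < j)%N -> enorm (iter j zf y) <= K'.
  move=> [y1 y2] j0; have [jk|kj] := leqP j k.+1.
    by rewrite le_max hK ?j0// ltW.
  have -> : j = ((j - k.+2).+1 + k.+1)%N by rewrite addSnnS subnK.
  rewrite iterD le_max; apply/orP; right; apply: iter_zf_below; exact: ltW.
pose B : set 'rV[R]_3 := [set v | forall i, v ord0 i \in `[(K' + 1), (K' + 1 + 1)]].
have cB : compact B.
  have := @rV_compact R 3 (fun=> `[(K' + 1), (K' + 1 + 1)]%classic); apply => _.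
  exact: segment_compact.
suff sB : B `<=` ~` \bigcup_(j in [set j | (0 < j)%N]) (iter j zf @` U).
  apply: (@box_capacity_gt0 _ (K' + 1) B) (jx U Ux B cB sB).
  by move=> v vB i; rewrite in_itv; exact: vB.
move=> v Bv [j /= j0 [y Uy yv]].
have := orbU y j Uy j0; rewrite yv; apply/negP; rewrite -ltNge.
apply: lt_le_trans (coord_le_enorm v 0); apply: lt_le_trans (ler_norm _).
have := Bv 0; rewrite in_itv /= => /andP[h1 _]; apply: lt_le_trans h1.
by rewrite ltrDl.
Unshelve. all: by end_near.
Qed.

Lemma julia_zf : julia zf = [set x | J x].
Proof. by apply/seteqP; split; [exact: julia_sub_J|exact: J_sub_julia]. Qed.

(** * Hairs and their endpoints *)

Definition same_itinerary (x y : 'rV[R]_3) : Prop :=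
  forall k, cell (iter k zf x) = cell (iter k zf y).

Lemma same_sym x y : same_itinerary x y -> same_itinerary y x.
Proof. by move=> xy k. Qed.

Lemma same_trans x y z : same_itinerary x y -> same_itinerary y z -> same_itinerary x z.
Proof. by move=> xy yz k; rewrite xy. Qed.

Lemma cell_dist x y : cell x = cell y ->
  `|x ord0 0 - y ord0 0| <= 2 /\ `|x ord0 1 - y ord0 1| <= 2.
Proof.
move=> xy; have [x0 x1] := in_cell_cell x; have [y0 y1] := in_cell_cell y.
rewrite -xy in y0 y1.
by split; [exact: same_interval_dist x0 y0|exact: same_interval_dist x1 y1].
Qed.

Lemma same_coord_le x y k : same_itinerary x y ->
  `|iter k zf x ord0 0| <= `|iter k zf y ord0 0| + 2 /\
  `|iter k zf x ord0 1| <= `|iter k zf y ord0 1| + 2.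
Proof.
move=> xy; have [d0 d1] := cell_dist (xy k).
have tri (a b : R) : `|a - b| <= 2 -> `|a| <= `|b| + 2.
  move=> ab; have -> : a = b + (a - b) by ring.
  by apply: (le_trans (ler_normD _ _)); rewrite lerD2l.
by split; exact: tri.
Qed.

Lemma far_above x z : z ord0 2 + 3 < x ord0 2 ->
  8 * enorm (zf z) <= enorm (zf x).
Proof.
move=> zx; rewrite !enorm_zf mulrCA ler_pM2l//.
apply: (@le_trans _ _ (expR (3 + z ord0 2))); last by rewrite ler_expR addrC ltW.
rewrite expRD ler_wpM2r ?expR_ge0//.
have e1 : 2 <= expR 1 :> R by apply: le_trans (expR_ge1Dx 1).
rewrite -[X in expR X]mul1r expRM_natr; apply: (@le_trans _ _ (2 ^+ 3)).
  by rewrite -natrX.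
by rewrite lerXn2r ?nnegrE ?expR_ge0.
Qed.

(** A point 3 units higher than another one has an image at least 8 times as far
    from the origin; if this image is not much farther away from the axis, it has
    to be higher again by 3 units. The hypothesis on the first two coordinates
    allows comparing points with different itineraries. *)
Lemma above_step x z : J x -> J z ->
  `|zf x ord0 0| <= `|zf z ord0 0| + 2 -> `|zf x ord0 1| <= `|zf z ord0 1| + 2 ->
  z ord0 2 + 3 < x ord0 2 -> zf z ord0 2 + 3 < zf x ord0 2.
Proof.
move=> Jx Jz h0 h1 zx; rewrite ltNge; apply/negP => h2.
have zb : 1 < enorm (zf z).
  by apply: (lt_trans height0_gt1); apply: J_enorm; exact: J_zf.
have far := far_above zx.
have near : enorm (zf x) <= enorm (zf z) + (2 + 2 + 3).
  apply: enorm_le_coordD => //.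
  rewrite !gtr0_norm//; exact: lt_trans height0_gt0 (J_height (J_zf _)).
lra.
Qed.

(** On an itinerary class this is a strict linear order: asymmetric because a gap
    of 3 units persists, total because expansion produces such a gap. *)
Definition lower (x y : 'rV[R]_3) : Prop :=
  exists k, iter k zf x ord0 2 + 3 < iter k zf y ord0 2.

Lemma above_iter x z k j : J x -> J z ->
  (forall i, `|iter i zf x ord0 0| <= `|iter i zf z ord0 0| + 2 /\
             `|iter i zf x ord0 1| <= `|iter i zf z ord0 1| + 2) ->
  iter k zf z ord0 2 + 3 < iter k zf x ord0 2 ->
  iter (j + k) zf z ord0 2 + 3 < iter (j + k) zf x ord0 2.
Proof.
move=> Jx Jz xz zx; elim: j => [//|j ih]; rewrite addSn /=.
have [h0 h1] := xz (j + k).+1; apply: above_step => //; exact: J_iter.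
Qed.

Lemma lower_asym x y : J x -> J y -> same_itinerary x y -> lower x y -> ~ lower y x.
Proof.
move=> Jx Jy xy [k hk] [l hl].
have h1 := above_iter l Jy Jx (fun i => same_coord_le i (same_sym xy)) hk.
have h2 := above_iter k Jx Jy (fun i => same_coord_le i xy) hl.
rewrite addnC in h2; lra.
Qed.

(** If no gap of 3 units ever appears, the iterates stay within distance 7 of each
    other, which expansion by [kappa] allows for equal points only. *)
Lemma lower_total x y : J x -> J y -> same_itinerary x y -> x <> y ->
  lower x y \/ lower y x.
Proof.
move=> Jx Jy xy neq; apply: contrapT => /not_orP[nxy nyx]; apply: neq.
have close k : `|iter k zf x ord0 2 - iter k zf y ord0 2| <= 3.
  rewrite ler_norml; apply/andP; split.
    rewrite leNgt; apply/negP => hk; apply: nxy; exists k; lra.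
  rewrite leNgt; apply/negP => hk; apply: nyx; exists k; lra.
have xy7 k : kappa ^+ k * enorm (x - y) <= 7.
  apply: (le_trans (iter_expanding Jx Jy (fun j _ => xy j))).
  apply: (le_trans (enorm_le_sum3 _)).
  have [d0 d1] := cell_dist (xy k).
  have dE i : (iter k zf x - iter k zf y) ord0 i =
    iter k zf x ord0 i - iter k zf y ord0 i by rewrite !mxE.
  rewrite !dE; apply: (le_trans (lerD (lerD d0 d1) (close k))); lra.
apply/eqP; rewrite -subr_eq0; apply/eqP/enorm_eq0/eqP.
rewrite eq_le enorm_ge0 andbT leNgt; apply/negP => xy0.
have [k hk] := big_power (7 / enorm (x - y)) kappa_gt1.
by have := xy7 k; rewrite leNgt -ltr_pdivrMr// hk.
Qed.

Lemma height_continuous k : continuous (fun x : 'rV[R]_3 => iter k zf x ord0 2 : R).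
Proof.
have cc : continuous (fun y : 'rV[R]_3 => y ord0 2) by exact: coord_continuous.
exact: (continuous_compose (@iter_zf_continuous k) cc).
Qed.

Lemma open_lower_l x : open [set y | lower x y].
Proof.
rewrite openE => y [k hk]; have := near_gt (@height_continuous k) hk.
by apply: filterS => z hz; exists k.
Qed.

Lemma open_lower_r x : open [set y | lower y x].
Proof.
rewrite openE => y [k]; rewrite -ltrBrDr => hk.
have := near_lt (@height_continuous k) hk.
by apply: filterS => z hz; exists k; rewrite -ltrBrDr.
Qed.

Lemma near_cell_iter x k : J x ->
  \forall y \near x, cell (iter k zf y) = cell (iter k zf x).
Proof.
move=> Jx; have := near_cell (J_iter k Jx).
exact: (@iter_zf_continuous k x).
Qed.

(** Cells are locally constant on [J]. *)
Lemma connected_same (H : set 'rV[R]_3) x y : connected H -> H `<=` J ->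
  H x -> H y -> same_itinerary x y.
Proof.
move=> cH HJ Hx Hy k.
pose P := [set z | cell (iter k zf z) = cell (iter k zf x)].
have PE : H `&` P = H.
  apply: cH.
  - by exists x.
  - exists (interior P); first exact: open_interior.
    apply/seteqP; split=> z [Hz Pz]; split=> //; last exact: interior_subset Pz.
    have := near_cell_iter k (HJ _ Hz).
    by apply: filterS => w wz; rewrite /P /= wz.
  - exists (~` interior (~` P)); first exact/open_closedC/open_interior.
    apply/seteqP; split=> z [Hz Pz]; split=> //.
      by move=> /interior_subset.
    apply: contrapT => nPz; apply: Pz; have := near_cell_iter k (HJ _ Hz).
    by apply: filterS => w wz; rewrite /P /= wz.
by have [_ ->] : (H `&` P) y by rewrite PE.
Qed.

Section Hair.
Variables (H : set 'rV[R]_3) (gamma : R -> 'rV[R]_3).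
Hypothesis gammaH : hair_parametrization H gamma.
Hypothesis HJ : H `<=` J.

Lemma hair_mem t : 0 <= t -> H (gamma t).
Proof.
move=> t0; have [_ <- _ _] := gammaH; exists t => //=.
by rewrite in_itv /= t0.
Qed.

Lemma hair_inj s t : 0 <= s -> 0 <= t -> gamma s = gamma t -> s = t.
Proof.
move=> s0 t0 st; have [_ _ [d _ dK] _] := gammaH.
by rewrite -(dK s) ?in_itv /= ?s0// st dK// in_itv /= t0.
Qed.

Lemma tail_connected t0 : 0 <= t0 -> connected (gamma @` `[t0, +oo[).
Proof.
move=> t00; apply: connected_continuous_connected.
  by apply/connected_intervalP; exact: interval_is_interval.
have [cg _ _ _] := gammaH; apply: continuous_subspaceW cg => t /=.
by rewrite !in_itv /= !andbT; exact: le_trans.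
Qed.

Lemma hair_connected : connected H.
Proof. by have [_ <- _ _] := gammaH; exact: tail_connected. Qed.

Lemma hair_same s t : 0 <= s -> 0 <= t -> same_itinerary (gamma s) (gamma t).
Proof.
by move=> s0 t0; apply: (connected_same hair_connected HJ); exact: hair_mem.
Qed.

(** The points of a hair stay in one beam, so that going to infinity means going
    up. *)
Lemma hair_unbounded t0 (K : R) : 0 <= t0 -> exists2 t, t0 <= t & K < gamma t ord0 2.
Proof.
move=> t00; have [_ _ _ ginf] := gammaH.
have Jg0 := HJ (hair_mem (lexx 0)).
pose B : R := `|K| + `|gamma 0 ord0 0| + `|gamma 0 ord0 1| + 2.
pose C : set 'rV[R]_3 := [set v | forall i, v ord0 i \in `[(- B), B]].
have cC : compact C.
  have := @rV_compact R 3 (fun=> `[(- B), B]%classic); apply => _.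
  exact: segment_compact.
have clC : closed C by apply: compact_closed => //; exact: norm_hausdorff.
have nC : \forall t \near +oo, ~ C (gamma t).
  have : nbhs (None : one_point_compactification 'rV[R]_3)
      ((Some @` (~` C)) `|` [set None]).
    by exists C.
  move=> /ginf gC; have gC' : \forall t \near +oo,
    ((Some @` (~` C)) `|` [set None]) (Some (gamma t)) by exact: gC.
  by apply: filterS gC' => t [[y nCy [<-]]|].
have : \forall t \near +oo, t0 <= t by apply: nbhs_pinfty_ge; exact: num_real.
move=> /filterI /(_ nC) /filter_ex[t [t0t nCt]]; exists t => //.
have t_ge0 : 0 <= t := le_trans t00 t0t.
rewrite ltNge; apply/negP => tK; apply: nCt.
have [h0 h1] := same_coord_le 0 (hair_same t_ge0 (lexx 0)).
have J0 : 0 < gamma t ord0 2.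
  exact: lt_trans height0_gt0 (J_height (HJ (hair_mem t_ge0))).
have := normr_ge0 K; have := ler_norm K; have := normr_ge0 (gamma 0 ord0 0).
have := normr_ge0 (gamma 0 ord0 1); rewrite /= in h0 h1 => n1 n0 nK nK0.
apply: ord3P; rewrite in_itv /= -ler_norml.
- by apply: (le_trans h0); rewrite /B; lra.
- by apply: (le_trans h1); rewrite /B; lra.
- by rewrite gtr0_norm// /B; lra.
Qed.

(** A point of the class above a point of the hair but off the hair would
    disconnect a tail of the hair into the points below and above it. *)
Lemma hair_upper t0 y : 0 <= t0 -> J y -> same_itinerary (gamma 0) y ->
  lower (gamma t0) y -> exists2 t, t0 <= t & gamma t = y.
Proof.
move=> t00 Jy sy lty; apply: contrapT => ny.
pose T := gamma @` `[t0, +oo[.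
have TJ t : t0 <= t -> J (gamma t) by move=> ?; apply/HJ/hair_mem; exact: le_trans t00 _.
have Ts t : t0 <= t -> same_itinerary (gamma t) y.
  move=> t0t; apply: same_trans sy; apply: hair_same => //; exact: le_trans t00 _.
have [t1 t01 h1] := hair_unbounded (y ord0 2 + 3) t00.
have lt1 : lower y (gamma t1) by exists 0%N.
have : T `&` [set z | lower z y] = T.
  apply: (tail_connected t00).
  - by exists (gamma t0); split=> //; exists t0; rewrite //= in_itv /= lexx.
  - by exists [set z | lower z y] => //; exact: open_lower_r.
  - exists (~` [set z | lower y z]); first exact/open_closedC/open_lower_l.
    apply/seteqP; split=> z [] [t] /=; rewrite in_itv /= andbT => t0t <- lz.
      split; first by exists t; rewrite //= in_itv /= t0t.
      exact: lower_asym (TJ _ t0t) Jy (Ts _ t0t) lz.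
    split; first by exists t; rewrite //= in_itv /= t0t.
    have [ty|//|/lz//] := lower_total (TJ _ t0t) Jy (Ts _ t0t).
    by apply: ny; exists t.
move=> TE; have : (T `&` [set z | lower z y]) (gamma t1).
  by rewrite TE; exists t1; rewrite //= in_itv /= t01.
by move=> [_ /=]; apply: lower_asym => //; [exact: TJ|exact/same_sym/Ts].
Qed.

End Hair.

(** By [endpoints_lowest] these are the endpoints. *)
Definition lowest (x : 'rV[R]_3) : Prop :=
  J x /\ forall y, J y -> same_itinerary x y -> ~ lower y x.

Lemma lowest_unique x y : lowest x -> lowest y -> same_itinerary x y -> x = y.
Proof.
move=> [Jx lx] [Jy ly] xy; apply: contrapT => nxy.
have [] := lower_total Jx Jy xy nxy; first exact: ly (same_sym xy).
exact: lx.
Qed.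

Section Decomposition.
Variable HH : set (set 'rV[R]_3).
Hypothesis HHJ : hair_decomposition [set x | J x] HH.

Lemma decomposition_sub H : HH H -> H `<=` J.
Proof. by have [_ _ U] := HHJ => HHH x Hx; have : [set x | J x] x by rewrite -U; exists H. Qed.

(** Each of two hairs in a class has points higher than any given point, so that
    they meet; a decomposition thus has a single hair in each class. *)
Lemma decomposition_class H x y : HH H -> H x -> J y -> same_itinerary x y -> H y.
Proof.
have [hairs triv U] := HHJ => HHH Hx Jy xy.
have [H' HH' H'y] : (\bigcup_(H in HH) H) y by rewrite U.
have [g gH] := hairs _ HHH; have [g' gH'] := hairs _ HH'.
have HJ := decomposition_sub HHH; have HJ' := decomposition_sub HH'.
have s0 : same_itinerary x (g 0).
  by apply: (connected_same (hair_connected gH) HJ) => //; exact: (hair_mem gH).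
have s0' : same_itinerary y (g' 0).
  by apply: (connected_same (hair_connected gH') HJ') => //; exact: (hair_mem gH').
have [t t0 gt] := hair_unbounded gH' HJ' (g 0 ord0 2 + 3) (lexx 0).
have H'g := hair_mem gH' t0.
have sg : same_itinerary (g 0) (g' t).
  apply: same_trans (hair_same gH' HJ' (lexx 0) t0).
  exact: same_trans (same_sym s0) (same_trans xy s0').
have [s s0'' gs] := hair_upper gH HJ (lexx 0) (HJ' _ H'g) sg (ex_intro _ 0%N gt).
have Hg : H (g' t) by rewrite -gs; exact: (hair_mem gH).
by rewrite (triv H H' HHH HH')//; exists (g' t).
Qed.

(** A point of the class lower than the endpoint would be on the hair, past the
    endpoint, and the part of the hair from there on would contain the endpoint
    again. *)
Lemma hair_endpoint_lowest H x : HH H -> hair_endpoint H x -> lowest x.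
Proof.
move=> HHH [g gH <-]; have HJ := decomposition_sub HHH.
have H0 := hair_mem gH (lexx 0); split; first exact: HJ.
move=> y Jy xy ly.
have Hy := decomposition_class HHH H0 Jy xy.
have [t t0 gt] : exists2 t, 0 <= t & g t = y.
  have [_ gE _ _] := gH; move: Hy; rewrite -gE => -[t].
  by rewrite /= in_itv /= andbT; exists t.
rewrite -gt in ly.
have [s ts gs] := hair_upper gH HJ t0 (HJ _ H0) (fun=> erefl) ly.
have s0 : s = 0 by apply: (hair_inj gH) => //; exact: le_trans t0 ts.
have t00 : t = 0 by apply/eqP; rewrite eq_le t0 andbT -s0.
by rewrite t00 in ly; exact: (lower_asym (HJ _ H0) (HJ _ H0) (fun=> erefl) ly ly).
Qed.

Lemma lowest_hair_endpoint x : lowest x -> exists2 H, HH H & hair_endpoint H x.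
Proof.
move=> lx; have [hairs _ U] := HHJ; have [Jx _] := lx.
have [H HHH Hx] : (\bigcup_(H in HH) H) x by rewrite U.
have [g gH] := hairs _ HHH; have HJ := decomposition_sub HHH.
exists H => //; exists g => //; apply: lowest_unique lx _.
  by apply: (hair_endpoint_lowest HHH); exists g.
apply: (connected_same (hair_connected gH) HJ) => //.
exact: (hair_mem gH).
Qed.

End Decomposition.

(** The existence of an endpoint provides a decomposition into hairs, and each
    decomposition has the same endpoints. *)
Lemma endpoints_lowest : endpoints [set x | J x] !=set0 ->
  endpoints [set x | J x] = [set x | lowest x].
Proof.
move=> [x0 [HH0 [HHJ0 _]]]; apply/seteqP; split=> x.
  by move=> [HH [HHJ [H HHH Hx]]] /=; exact: (hair_endpoint_lowest HHJ HHH Hx).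
move=> lx; exists HH0; split=> //.
exact: (lowest_hair_endpoint HHJ0 lx).
Qed.

(** * Moving endpoints to infinity *)

(** Translations by periods of the map. *)
Definition shift4 (i : int) (x : 'rV[R]_3) : 'rV[R]_3 := x + row3 (4 * i%:~R) 0 0.

Lemma shift4E i x : (shift4 i x ord0 0 = x ord0 0 + 4 * i%:~R) *
  (shift4 i x ord0 1 = x ord0 1) * (shift4 i x ord0 2 = x ord0 2).
Proof. by rewrite /shift4 !mxE /= !addr0. Qed.

Lemma in_cell_shift4 n m i x : in_cell n m x -> in_cell (n + 2 * i) m (shift4 i x).
Proof.
move=> [xn xm]; split; rewrite shift4E//.
by rewrite intrD intrM (_ : _ - _ = x ord0 0 - 2 * n%:~R)//; ring.
Qed.

Lemma zf_shift4 i x : zf (shift4 i x) = zf x.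
Proof.
have cx := in_cell_cell x; have cx' := in_cell_shift4 i cx.
rewrite (zfE cx) (zfE cx') shift4E; congr (_ *: _).
have s2 n : (-1) ^ (n + 2 * i) = (-1) ^ n :> R.
  by rewrite signzD (_ : 2 * i = i + i) ?signzD ?signz_mul ?mulr1//; ring.
have -> : direction ((cell x).1 + 2 * i) (cell x).2 (shift4 i x) =
    row3 (h (fold ((cell x).1 + 2 * i) (cell x).2 (shift4 i x)) ord0 0)
      (h (fold ((cell x).1 + 2 * i) (cell x).2 (shift4 i x)) ord0 1)
      ((-1) ^ ((cell x).1 + (cell x).2) *
       h (fold ((cell x).1 + 2 * i) (cell x).2 (shift4 i x)) ord0 2).
  by rewrite /direction addrAC s2.
suff -> : fold ((cell x).1 + 2 * i) (cell x).2 (shift4 i x) =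
    fold (cell x).1 (cell x).2 x by [].
rewrite /fold !shift4E s2; congr (row2 (_ * _) _).
by rewrite intrD intrM; ring.
Qed.

Lemma iter_shift4 k i x : iter k.+1 zf (shift4 i x) = iter k.+1 zf x.
Proof. by rewrite !iterSr zf_shift4. Qed.

Lemma J_shift4 i x : J x -> J (shift4 i x).
Proof.
by move=> Jx [|k]; [rewrite /= shift4E; exact: J_height|rewrite iter_shift4; exact: Jx].
Qed.

Lemma cell_shift4 i x : J x -> cell (shift4 i x) = ((cell x).1 + 2 * i, (cell x).2).
Proof.
by move=> Jx; apply: J_cell (J_shift4 i Jx) _; exact/in_cell_shift4/in_cell_cell.
Qed.

Lemma iter_shift4_height k i x : iter k zf (shift4 i x) ord0 2 = iter k zf x ord0 2.
Proof. by case: k => [|k]; rewrite ?iter_shift4//= shift4E. Qed.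

(** Periodicity makes the shift of the far iterate a point of [J] with the same
    future. A point of the class lower than the new one would, shifted back and
    pulled back along the old itinerary, be lower than the old one. *)
Lemma perturb_lowest x N i : lowest x -> exists x', [/\ lowest x',
  iter N zf x' = shift4 i (iter N zf x) &
  forall k, (k < N)%N -> cell (iter k zf x') = cell (iter k zf x)].
Proof.
move=> [Jx lx]; have JNx := J_iter N Jx.
have [x' [Jx' fx' cx']] := pullback N Jx (J_shift4 i JNx).
exists x'; split=> //; split=> // y' Jy' xy' [k0 hk0].
have JNy' := J_iter N Jy'.
have [y [Jy fy cy]] := pullback N Jx (J_shift4 (- i) JNy').
have iterN (u v : 'rV[R]_3) (l : int) : iter N zf u = shift4 l (iter N zf v) ->
    forall k, iter (k + N) zf u = iter k zf (shift4 l (iter N zf v)).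
  by move=> uv k; rewrite iterD uv.
have yN := iterN _ _ _ fy; have xN := iterN _ _ _ fx'.
have xy : same_itinerary x y.
  move=> k; have [kN|Nk] := ltnP k N; first by rewrite cy.
  rewrite -(subnK Nk) yN; case: (k - N)%N => [|j]; last first.
    rewrite iter_shift4 -iterD -xy' xN iter_shift4 -iterD//.
  rewrite add0n [iter 0 _ _]/iter cell_shift4//.
  have := xy' N; rewrite fx' cell_shift4// => <-.
  by case: (cell (iter N zf x)) => a b; congr pair; rewrite [_.1]/=; ring.
apply: (lx y Jy xy); exists (N + k0)%N.
have le_xy' : forall j, `|iter j zf x' ord0 0| <= `|iter j zf y' ord0 0| + 2 /\
    `|iter j zf x' ord0 1| <= `|iter j zf y' ord0 1| + 2.
  by move=> j; exact: same_coord_le.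
have := above_iter N Jx' Jy' le_xy' hk0.
by rewrite addnC xN yN !iter_shift4_height -!iterD.
Qed.

(** A shift comparable with the modulus multiplies the modulus by at most 9, which
    in the previous iterate is a change of height by at most 8 within a cell; the
    remaining inverse branches contract by [kappa]. *)
Lemma perturb_near x x' N i : J x -> J x' ->
  iter N.+1 zf x' = shift4 i (iter N.+1 zf x) ->
  (forall k, (k < N.+1)%N -> cell (iter k zf x') = cell (iter k zf x)) ->
  enorm (iter N.+1 zf x) <= i%:~R <= enorm (iter N.+1 zf x) + 1 ->
  kappa ^+ N * enorm (x - x') <= 12.
Proof.
move=> Jx Jx' fx' cx' /andP[i1 i2].
set p := iter N.+1 zf x in fx' i1 i2 *.
have p1 : 1 < enorm p by apply: (lt_trans height0_gt1); apply: J_enorm; exact: (J_iter N.+1).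
apply: (le_trans (iter_expanding Jx Jx' _)).
  by move=> k kN; rewrite cx'// ltnW.
set u := iter N zf x; set v := iter N zf x'.
have uv : cell u = cell v by rewrite /u /v cx'.
have zu : zf u = p by []. have zv : zf v = shift4 i p by [].
have pp' : enorm p <= enorm (shift4 i p).
  rewrite enorm_le_sqr ?enorm_ge0// !sqr_enorm3 !shift4E !lerD2r.
  rewrite -subr_ge0 (_ : _ - _ = 4 * i%:~R * (2 * p ord0 0 + 4 * i%:~R)); last by ring.
  have := coord_le_enorm p 0; rewrite ler_norml => /andP[h1 h2].
  by apply: mulr_ge0; lra.
have p'p : enorm (shift4 i p) <= 9 * enorm p.
  have i0 : 0 <= 4 * i%:~R :> R by lra.
  have : enorm (shift4 i p) <= enorm p + (4 * i%:~R + 0 + 0).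
    apply: enorm_le_coordD; rewrite ?shift4E ?addr0//.
    by apply: (le_trans (ler_normD _ _)); rewrite lerD2l ger0_norm.
  by move=> h1; lra.
have uv2 : u ord0 2 <= v ord0 2.
  by move: pp'; rewrite -zu -zv !enorm_zf ler_pM2l// ler_expR.
have vu2 : v ord0 2 - u ord0 2 <= 8.
  have : expR (v ord0 2 - u ord0 2) <= 9.
    move: p'p; rewrite -zv -zu !enorm_zf expRB ler_pdivrMr ?expR_gt0//.
    by rewrite mulrCA ler_pM2l.
  by move=> h1; have h2 := expR_ge1Dx (v ord0 2 - u ord0 2); lra.
have [d0 d1] := cell_dist uv.
have d2 : `|u ord0 2 - v ord0 2| <= 8 by rewrite distrC ger0_norm// subr_ge0.
have dE j : (u - v) ord0 j = u ord0 j - v ord0 j by rewrite !mxE.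
apply: (le_trans (enorm_le_sum3 _)); rewrite !dE.
apply: (le_trans (lerD (lerD d0 d1) d2)); lra.
Qed.

(** * Endpoints and infinity form a connected set *)

Section Bounded_clopen.
Variables (U K : set 'rV[R]_3).
Hypothesis openU : open U.
Hypothesis compactK : compact K.
Hypothesis UK : forall x, lowest x -> (U x <-> K x).

Lemma compact_bound : exists b : R, forall x, K x -> enorm x <= b.
Proof.
have [M [_ MK]] := compact_bounded compactK.
exists (3 * (`|M| + 1)) => x Kx.
have M1 : M < `|M| + 1 by have := ler_norm M; lra.
have := MK _ M1 x Kx; rewrite /= [`|x|]mx_normrE => /bigmax_leP[_ xM].
apply: (le_trans (enorm_le_sum3 _)).
have := xM (ord0, 0) isT; have := xM (ord0, 1) isT; have := xM (ord0, 2) isT.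
rewrite /=; lra.
Qed.

(** The shifts go to infinity, and orbits of points of a bounded set up to a fixed
    time are bounded. *)
Lemma exit_shift x N (i0 : nat) (X : nat -> 'rV[R]_3) : J x ->
  (forall i, iter N.+1 zf (X i) = shift4 (Posz i) (iter N.+1 zf x)) ->
  K (X i0) -> exists2 i, (i0 <= i)%N & K (X i) /\ ~ K (X i.+1).
Proof.
move=> Jx fX K0; apply: contrapT => nex.
have KX j : K (X (i0 + j)%N).
  elim: j => [|j ih]; first by rewrite addn0.
  apply: contrapT => nK; apply: nex; exists (i0 + j)%N; first exact: leq_addr.
  by rewrite -addnS.
have [b Kb] := compact_bound.
have [c fc] := iter_zf_bound b N.+1.
set p := iter N.+1 zf x in fX.
pose j := (Num.truncn (c + enorm p)).+1.
have hj : c + enorm p < j%:R by exact: truncnS_gt.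
have : enorm (iter N.+1 zf (X (i0 + j)%N)) <= c.
  apply: fc; last by rewrite leqnn.
  apply: le_trans (ler_norm _) _; apply: le_trans (coord_le_enorm _ _) _.
  exact: Kb.
apply/negP; rewrite -ltNge fX; apply: lt_le_trans (coord_le_enorm _ 0).
rewrite shift4E; apply: lt_le_trans (ler_norm _).
have : j%:R <= (Posz (i0 + j)%N)%:~R :> R by rewrite -pmulrn ler_nat leq_addl.
have := coord_le_enorm p 0; rewrite ler_norml => /andP[h1 h2] h3.
have : 0 <= j%:R :> R by rewrite ler0n.
lra.
Qed.

Definition far_at (N : nat) (x : 'rV[R]_3) : Prop :=
  enorm (iter N zf x) <= 2 * `|iter N zf x ord0 0|.

(** The constant 4 is the length of one period. *)
Definition near_exit (N : nat) (x : 'rV[R]_3) : Prop :=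
  exists x', [/\ lowest x', ~ U x' & kappa ^+ N * enorm (x - x') <= 4].

Definition cell_le (x y : 'rV[R]_3) : Prop :=
  `|(cell x).1| <= `|(cell y).1| /\ (cell x).2 = (cell y).2.

Lemma norm_le_shift (a b : int) : `|a| <= b -> `|a| <= `|a + 2 * b|.
Proof.
move=> ab; apply: (le_trans ab); apply: le_trans (ler_norm _).
by move: ab; rewrite ler_norml => /andP[h1 _]; lra.
Qed.

(** The shifts start at the modulus of the far iterate. They are then large enough
    for the iterate to be far sideways and for its cell to move away from the
    axis, and still so small that the point has hardly moved and is in [K]. *)
Lemma exit_step x N0 : lowest x -> U x -> exists x' N, [/\ (N0 < N)%N,
  lowest x' /\ U x', far_at N x', near_exit N x' &
  cell_le (iter N zf x) (iter N zf x') /\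
  (forall k, k <> N -> cell (iter k zf x') = cell (iter k zf x))].
Proof.
move=> lx Ux; have [Jx _] := lx.
have [e e0 eU] := near_box (open_nbhs_nbhs (conj openU Ux)).
(* The constant 12 comes from [perturb_near]. *)
have [k0 hk0] := big_power (12 / e) kappa_gt1.
pose N := (k0 + N0)%N.
have hN : 12 / e < kappa ^+ N.
  by apply: (lt_le_trans hk0); rewrite ler_weXn2l ?leq_addr// (ltW kappa_gt1).
set p := iter N.+1 zf x.
have p1 : 1 < enorm p by apply: (lt_trans height0_gt1); apply: J_enorm; exact: (J_iter N.+1).
have [X XP] := boolp.choice (fun i : nat => perturb_lowest N.+1 (Posz i) lx).
rewrite -/p in XP.
pose i0 := (Num.truncn (enorm p)).+1.
have i0p : enorm p <= (Posz i0)%:~R <= enorm p + 1.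
  rewrite -pmulrn ltW ?truncnS_gt//= -natr1 lerD2r.
  by have /andP[] := truncn_itv (enorm_ge0 p).
have JX i : J (X i) by have [[]] := XP i.
have K0 : K (X i0).
  have [lX fX cX] := XP i0.
  apply/(UK lX)/eU => j.
  have := perturb_near Jx (JX i0) fX cX i0p.
  rewrite -ler_pdivlMl ?(exprn_gt0 _ kappa_gt0)// => xX.
  have dE : (x - X i0) ord0 j = x ord0 j - X i0 ord0 j by rewrite !mxE.
  rewrite -dE; apply: (le_lt_trans (coord_le_enorm _ _)).
  apply: (le_lt_trans xX); rewrite ltr_pdivrMl ?(exprn_gt0 _ kappa_gt0)// mulrC.
  by rewrite mulrC -ltr_pdivrMr.
have [i i0i [Ki nKi]] := exit_shift Jx (fun i => let: And3 _ fX _ := XP i in fX) K0.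
have [lX fX cX] := XP i; have [lX' fX' cX'] := XP i.+1.
have pi : enorm p <= (Posz i)%:~R.
  by have /andP[h1 _] := i0p; apply: (le_trans h1); rewrite -!pmulrn ler_nat.
have := coord_le_enorm p 0; rewrite ler_norml => /andP[p01 p02].
exists (X i), N.+1; split=> //.
- by rewrite ltnS leq_addl.
- by split=> //; apply/(UK lX).
- rewrite /far_at fX; apply: (le_trans (enorm_le_sum3 _)).
  rewrite !shift4E.
  have h0 : `|p ord0 0 + 4 * (Posz i)%:~R| = p ord0 0 + 4 * (Posz i)%:~R.
    by rewrite ger0_norm//; lra.
  by rewrite h0; have h1 := coord_le_enorm p 1; have h2 := coord_le_enorm p 2; lra.
- exists (X i.+1); split=> //; first by move=> /(UK lX').
  have cXX k : (k < N.+1)%N -> cell (iter k zf (X i)) = cell (iter k zf (X i.+1)).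
    by move=> kN; rewrite cX// cX'.
  apply: (le_trans (iter_expanding (JX i) (JX i.+1) cXX)).
  apply: (le_trans (enorm_le_sum3 _)); rewrite fX fX'.
  have dE j : (shift4 (Posz i) p - shift4 (Posz i.+1) p) ord0 j =
    shift4 (Posz i) p ord0 j - shift4 (Posz i.+1) p ord0 j by rewrite !mxE.
  rewrite !dE !shift4E !subrr !normr0 !addr0.
  rewrite (_ : _ - _ = - 4); first by rewrite normrN ger0_norm.
  by rewrite -!pmulrn -natr1; ring.
- split.
    rewrite /cell_le fX cell_shift4//; last exact: (J_iter N.+1).
    rewrite -/p /=; split=> //.
    have [cp _] := in_cell_cell p.
    have c1i : `|(cell p).1| <= Posz i.
      rewrite -(ler_int R) intr_norm.
      move: cp; rewrite ler_norml => /andP[h1 h2].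
      by rewrite ler_norml; apply/andP; split; lra.
    exact: norm_le_shift.
  move=> k kN; have [kN1|kN1] := ltnP k N.+1; first exact: cX.
  have kN2 : (N.+1 < k)%N by rewrite ltn_neqAle kN1 eq_sym andbT; apply/eqP.
  have -> : k = ((k - N.+2).+1 + N.+1)%N by rewrite addSnnS subnK.
  by rewrite !iterD fX iter_shift4.
Qed.

Lemma cell_le_refl x : cell_le x x. Proof. by split. Qed.

Lemma cell_le_trans x y z : cell_le x y -> cell_le y z -> cell_le x z.
Proof. by move=> [h1 h2] [h3 h4]; split; [exact: le_trans h3|rewrite h2]. Qed.

Lemma cell_le_coord x y : cell_le x y ->
  `|x ord0 0| <= `|y ord0 0| + 2 /\ `|x ord0 1| <= `|y ord0 1| + 2.
Proof.
move=> [c1 c2]; have [x0 x1] := in_cell_cell x; have [y0 y1] := in_cell_cell y.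
rewrite c2 in x1.
have tri (a b : R) : `|a| <= `|b| + `|a - b|.
  by rewrite -[X in `|X| <= _](addrNK b) addrC ler_normD.
split; last first.
  by apply: (le_trans (tri _ (y ord0 1))); rewrite lerD2l; exact: same_interval_dist x1 y1.
have c1R : `|2 * (cell x).1%:~R : R| <= `|2 * (cell y).1%:~R|.
  by rewrite !normrM ler_wpM2l// -!intr_norm ler_int.
have h1 := tri (x ord0 0) (2 * (cell x).1%:~R).
have h2 := tri (2 * (cell y).1%:~R) (y ord0 0).
rewrite distrC in h2; lra.
Qed.

(** If [z] were a lower point in the class of the limit, then [z] would be lower
    than some [x j] too, by continuity, and would remain so because the orbit of
    [x j] is nowhere farther from the axis by more than a cell. At time [N j] the
    iterate of [z] would have a modulus at least 8 times smaller than that of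
    [x j], which is comparable with its distance to the axis; but the two
    iterates are in the same cell. *)
Lemma lowest_limit (x : nat -> 'rV[R]_3) (N : nat -> nat) y : J y ->
  (forall j, lowest (x j)) -> (forall j, (j <= N j)%N) ->
  (forall j, far_at (N j) (x j)) ->
  (forall j k, cell_le (iter k zf (x j)) (iter k zf y)) ->
  (forall j, cell (iter (N j) zf (x j)) = cell (iter (N j) zf y)) ->
  (forall V j, nbhs y V -> exists2 i, (j <= i)%N & V (x i)) ->
  lowest y.
Proof.
move=> Jy lx jN farx xy Nxy cl; split=> // z Jz yz [k hk].
have nV : \forall w \near y, iter k zf z ord0 2 + 3 < iter k zf w ord0 2.
  exact: (near_gt (@height_continuous k) hk).
have [j kj hj] := cl _ k.+1 nV.
have [Jx _] := lx j.
have xz i : `|iter i zf (x j) ord0 0| <= `|iter i zf z ord0 0| + 2 /\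
    `|iter i zf (x j) ord0 1| <= `|iter i zf z ord0 1| + 2.
  by apply: cell_le_coord; rewrite /cell_le -yz; exact: xy.
have kN : (k < N j)%N by apply: leq_trans kj (jN j).
have hN := above_iter (N j - k.+1)%N Jx Jz xz hj.
have NE : N j = (N j - k.+1 + k).+1 by rewrite -addnS subnK.
have far := far_above hN; rewrite -!iterS -NE in far.
have [h0 _] := xz (N j).
have := farx j; rewrite /far_at => h1.
have h2 := coord_le_enorm (iter (N j) zf z) 0.
have h3 : 1 < enorm (iter (N j) zf z).
  by apply: (lt_trans height0_gt1); apply: J_enorm; exact: J_iter.
lra.
Qed.

(** The sequence obtained by iterating [exit_step] at later and later times has
    converging itineraries. Its accumulation points are endpoints by
    [lowest_limit] and belong to [U] and to the closure of the endpoints off [U]. *)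
Lemma no_bounded_clopen x0 : lowest x0 -> U x0 -> False.
Proof.
move=> lx0 Ux0.
pose good (s : 'rV[R]_3 * nat) := lowest s.1 /\ U s.1.
pose next (s t : 'rV[R]_3 * nat) := [/\ (s.2 < t.2)%N, far_at t.2 t.1,
  near_exit t.2 t.1, cell_le (iter t.2 zf s.1) (iter t.2 zf t.1) &
  forall k, k <> t.2 -> cell (iter k zf t.1) = cell (iter k zf s.1)].
have step s : exists t, good s -> good t /\ next s t.
  have [gs|ngs] := pselect (good s); last by exists s.
  have [lx Ux] := gs.
  have [x' [N [h1 h2 h3 h4 [h5 h6]]]] := exit_step s.2 lx Ux.
  by exists (x', N) => _; split.
have [g gP] := boolp.choice step.
pose s (j : nat) := iter j.+1 g (x0, 0%N).
have good0 j : good (iter j g (x0, 0%N)).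
  by elim: j => [|j ih] //=; have [] := gP _ ih.
have goods j : good (s j) by exact: good0.
have nexts j : next (iter j g (x0, 0%N)) (s j) by have [] := gP _ (good0 j).
have nexts' j : next (s j) (s j.+1) by exact: nexts j.+1.
pose x j := (s j).1; pose N j := (s j).2.
have jN j : (j <= N j)%N.
  elim: j => [//|j ih]; have [h1 _ _ _ _] := nexts' j.
  exact: leq_ltn_trans ih h1.
have N_mono i j : (i <= j)%N -> (N i <= N j)%N.
  move=> /subnK <-; elim: (j - i)%N => [//|l ih].
  have [h1 _ _ _ _] := nexts' (l + i)%N.
  exact: leq_trans ih (ltnW h1).
have stable k i j : (i <= j)%N -> (k <= N i)%N ->
    cell (iter k zf (x j)) = cell (iter k zf (x i)).
  move=> /subnK <- ki; elim: (j - i)%N => [//|l ih].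
  have [h1 _ _ _ h2] := nexts' (l + i)%N; rewrite addSn /x h2 ?ih// => kE.
  have := leq_trans ki (N_mono i (l + i)%N (leq_addl _ _)).
  by rewrite leqNgt kE h1.
have mono k i j : (i <= j)%N -> cell_le (iter k zf (x i)) (iter k zf (x j)).
  move=> /subnK <-; elim: (j - i)%N => [|l ih]; first exact: cell_le_refl.
  apply: cell_le_trans ih _; have [_ _ _ h1 h2] := nexts' (l + i)%N.
  have [->|/eqP kN] := eqVneq k (s (l + i).+1).2; first exact: h1.
  rewrite /cell_le /x h2//; exact: cell_le_refl.
have lx j : lowest (x j) by have [] := goods j.
have Kx j : K (x j) by have [h1 h2] := goods j; apply/(UK h1).
have [y [Ky cly]] : exists y, K y /\ cluster (x @ \oo) y.
  have KF : (x @ \oo) K by exists 0%N => // j _; exact: Kx.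
  by have [y [Ky cly]] := compactK _ KF; exists y.
have cl V j : nbhs y V -> exists2 i, (j <= i)%N & V (x i).
  move=> yV; have Fj : (x @ \oo) [set x i | i in [set i | (j <= i)%N]].
    by exists j => // i ji; exists i.
  by have [_ [[i ji <-] Vi]] := cly _ _ Fj yV; exists i.
have Jy : J y.
  apply: closed_J => V yV; have [i _ Vi] := cl V 0%N yV.
  by exists (x i); split=> //; have [] := lx i.
have celly k j : (k <= N j)%N -> cell (iter k zf (x j)) = cell (iter k zf y).
  move=> kj; have [i ji <-] := cl _ j (near_cell_iter k Jy).
  by rewrite (stable k j i).
have ly : lowest y.
  apply: (@lowest_limit x N) => //.
  - by move=> j; have [_ h1 _ _ _] := nexts j.
  - move=> j k; have kN : (k <= N (maxn j k))%N.
      by apply: leq_trans (jN _); exact: leq_maxr.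
    rewrite /cell_le -(celly k _ kN); exact: mono (leq_maxl _ _).
  - by move=> j; exact: celly.
have Uy : U y by apply/(UK ly).
have [e e0 eU] := near_box (open_nbhs_nbhs (conj openU Uy)).
(* From [near_exit]: 4 / kappa ^+ N j is less than e / 2. *)
have [k0 hk0] := big_power (8 / e) kappa_gt1.
have ny : \forall w \near y, forall i, `|y ord0 i - (w : 'rV[R]_3) ord0 i| < e / 2.
  have e20 : 0 < e / 2 by rewrite divr_gt0.
  have n0 := near_coord_dist y 0 e20; have n1 := near_coord_dist y 1 e20.
  have n2 := near_coord_dist y 2 e20.
  by near=> w; apply: ord3P; near: w.
have [j kj hj] := cl _ k0 ny.
have [_ _ [x' [lx' nUx' xx']] _ _] := nexts j.
apply: nUx'; apply: eU => i.
have hN : 8 / e < kappa ^+ N j.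
  apply: (lt_le_trans hk0); rewrite ler_weXn2l ?(leq_trans kj)//.
  exact: ltW kappa_gt1.
have : `|x j ord0 i - x' ord0 i| < e / 2.
  have dE : (x j - x') ord0 i = x j ord0 i - x' ord0 i by rewrite !mxE.
  rewrite -dE; apply: (le_lt_trans (coord_le_enorm _ _)).
  rewrite -ler_pdivlMl ?(exprn_gt0 _ kappa_gt0)// in xx'.
  apply: (le_lt_trans xx'); rewrite ltr_pdivrMl ?(exprn_gt0 _ kappa_gt0)//.
  move: hN; rewrite ltr_pdivrMr// => hN; lra.
have := hj i; have -> : y ord0 i - x' ord0 i =
  (y ord0 i - x j ord0 i) + (x j ord0 i - x' ord0 i) by ring.
by move=> h1 h2; apply: (le_lt_trans (ler_normD _ _)); lra.
Unshelve. all: by end_near.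
Qed.

End Bounded_clopen.

(** * Explosion at infinity *)

Lemma open_val_cell (E : set 'rV[R]_3) k c : E `<=` J ->
  open [set z : E | cell (iter k zf (val z)) = c].
Proof.
move=> EJ.
exists (interior [set z | cell (iter k zf z) = c]); first exact: open_interior.
apply/seteqP; split=> z /=; first by move/interior_subset.
move=> zc; have Jz : J (val z) by apply: EJ; exact: set_valP.
by have := near_cell_iter k Jz; apply: filterS => w; rewrite /= zc.
Qed.

(** Distinct endpoints are separated by a cell of their itineraries. *)
Lemma lowest_zero_dimensional : zero_dimensional [set x | lowest x].
Proof.
move=> x y xy.
have lowval (z : [set x | lowest x]) : lowest (val z) by exact: (set_valP z).
have EJ : [set x | lowest x] `<=` J by move=> z [].
have [k kxy] : exists k, cell (iter k zf (val x)) <> cell (iter k zf (val y)).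
  apply: contrapT => nk; move/eqP: xy; apply; apply: val_inj.
  apply: lowest_unique => // k; apply: contrapT => kxy; apply: nk; by exists k.
exists [set z | cell (iter k zf (val z)) = cell (iter k zf (val x))]; split=> //.
- split; first exact: open_val_cell.
  rewrite -openC.
  have -> : ~` [set z : [set x | lowest x] | cell (iter k zf (val z)) =
      cell (iter k zf (val x))] = \bigcup_(c in [set c | c <> cell (iter k zf (val x))])
      [set z | cell (iter k zf (val z)) = c].
    by apply/seteqP; split=> z /=; 
      [exists (cell (iter k zf (val z)))|by move=> [c /= cx zc]; rewrite zc].
  by apply: bigcup_open => c _; exact: open_val_cell.
- by move=> /esym.
Qed.

(** A neighbourhood of infinity contains the complement of a compact set, so that
    [no_bounded_clopen] applies. *)
Lemma clopen_without_infty (B O C : set (one_point_compactification 'rV[R]_3)) :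
  let A := Some @` [set x | lowest x] `|` [set None] in
  open O -> closed C -> B = A `&` O -> B = A `&` C -> ~ B None -> B = set0.
Proof.
move=> A oO cC BO BC nB; apply/seteqP; split=> // -[x|] Bx //.
have AS y : lowest y -> A (Some y) by move=> ly; left; exists y.
have lx : lowest x.
  by move: Bx; rewrite BO => -[[[y ly [<-]]|//] _].
have nCinf : ~ C None by move=> CN; apply: nB; rewrite BC; split=> //; right.
have [W [cW clW] Wsub] : nbhs (None : one_point_compactification 'rV[R]_3) (~` C).
  by apply: open_nbhs_nbhs; split=> //; exact: closed_openC.
pose U : set 'rV[R]_3 := Some @^-1` O.
pose K : set 'rV[R]_3 := Some @^-1` C.
have /continuousP open_pre := @one_point_compactification_some_continuous 'rV[R]_3.
have oU : open U by exact: open_pre.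
have clK : closed K by rewrite -openC; exact: open_pre _ (closed_openC cC).
have KW : K `<=` W.
  move=> y Ky; apply: contrapT => nWy.
  by apply: (Wsub (Some y)) => //; left; exists y.
have cK : compact K by exact: subclosed_compact clK cW KW.
apply: (@no_bounded_clopen U K oU cK _ x lx).
  move=> y ly; split=> Uy.
    have : B (Some y) by rewrite BO; split; [exact: AS|exact: Uy].
    by rewrite BC => -[_].
  have : B (Some y) by rewrite BC; split; [exact: AS|exact: Uy].
  by rewrite BO => -[_].
by move: Bx; rewrite BO => -[_].
Qed.

Lemma lowest_explosion : explosion_at_infinity [set x | lowest x].
Proof.
split; first exact: lowest_zero_dimensional.
move=> B [b Bb] [V oV BV] [C cC BC].
set A := (X in B = X `&` V) in BV BC *.
have [BN|nBN] := pselect (B None); last first.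
  by move: Bb; rewrite (clopen_without_infty oV cC BV BC nBN).
have B'0 : A `\` B = set0.
  apply: (@clopen_without_infty _ (~` C) (~` V)).
  - exact: closed_openC.
  - exact: open_closedC.
  - apply/seteqP; split=> z [Az nz]; split=> // Dz; apply: nz; first by rewrite BC.
    by move: Dz; rewrite BC => -[_].
  - apply/seteqP; split=> z [Az nz]; split=> // Dz; apply: nz; first by rewrite BV.
    by move: Dz; rewrite BV => -[_].
  - by move=> [].
apply/seteqP; split; first by rewrite BV => z [].
by move=> z Az; apply: contrapT => nBz; have : (A `\` B) z by []; rewrite B'0.
Qed.

End Zorich.

Theorem theorem2 (R : realType) (L lambda : R) (h : 'rV[R]_2 -> 'rV[R]_3)
    (Z : 'rV[R]_3 -> 'rV[R]_3)
    (h_bilipschitz : bilipschitz_on L square h)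
    (h_onto : h @` square = upper_hemisphere)
    (h_sense_preserving : sense_preserving_on_square h)
    (Z_zorich : zorich_map h Z)
    (lambda_gt0 : 0 < lambda)
    (lambda_lt : lambda < expR (- (ln L + L))) :
  explosion_at_infinity (endpoints (julia (fun x => lambda *: Z x))).
Proof.
have -> : julia (fun x => lambda *: Z x) = [set x | J L lambda Z x].
  exact: julia_zf h_bilipschitz h_onto Z_zorich lambda_gt0 lambda_lt.
(* Without a decomposition into hairs there are no endpoints, and the point at
   infinity alone is connected. *)
have [E0|E0] := eqVneq (endpoints [set x | J L lambda Z x]) set0; last first.
  rewrite (endpoints_lowest h_bilipschitz h_onto Z_zorich lambda_gt0 lambda_lt).
    exact: lowest_explosion h_bilipschitz h_onto Z_zorich lambda_gt0 lambda_lt.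
  exact/set0P.
rewrite E0; split; last by rewrite image_set0 set0U; exact: connected1.
by move=> [x xE]; exfalso; move: xE; rewrite in_set0.
Qed.
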